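(* Let $R$ be a commutative ring with unit containing $\mathbb{Q}$, $n\ge 1$, and let $F=(F_i)_{1\le i\le n}$, $G=(G_i)_{1\le i\le n}$ be systems of formal power series in $R[[X_1,\ldots,X_n]]$ without constant term. Let $d\ge 1$, $i,j_1,\ldots,j_d\in[n]$, $I=[1]$, $J=[d]$, $\tau_s:I\to[n]$ with $\tau_s(1)=i$, $\tau_{\bar u}:J\to[n]$ with $\tau_{\bar u}(\nu)=j_\nu$, and $U=s_i\bar u_{j_1}\cdots\bar u_{j_d}\exp(\bar sF(t)+\bar tG(u))$. Then $$\int d\bar s\,ds\,d\bar t\,dt\,d\bar u\,du\ e^{-\bar s s-\bar t t-\bar u u}\ U=\sum_{[E,\mathcal F]}\frac{\mathcal A_{Fey}(E,\mathcal F,\tau_s,\tau_{\bar u})}{\#Aut(E,\mathcal F)},$$ where the sum is over equivalence classes of pairs $(E,\mathcal F)$ made of a finite set $E$ and a Feynman diagram structure $\mathcal F$ on $E$; $(E,\mathcal F)$ and $(E',\mathcal F')$ are equivalent if there is a bijection $\sigma:E\to E'$ with $Fey(\sigma)(\mathcal F)=\mathcal F'$; and in the sum $(E,\mathcal F)$ denotes any representative of $[E,\mathcal F]$.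
   Context: $[k]=\{1,\ldots,k\}$; $\#$ is cardinality; $\delta$ is Kronecker's symbol. For $F_i$ put $F^{[p]}_{i,j_1\ldots j_p}=\left.\frac{\partial^p F_i}{\partial X_{j_1}\cdots\partial X_{j_p}}\right|_{X=0}$, and similarly $G^{[p]}_{i,j_1\ldots j_p}$. $\bar s,s,\bar t,t,\bar u,u$ are six vectors of $n$ indeterminates, $K=R[[\bar s,s,\bar t,t,\bar u,u]]$, $\bar sF(t)=\sum_i\bar s_iF_i(t)$, $\bar tG(u)=\sum_i\bar t_iG_i(u)$. Formal Gaussian integral (identity covariances): for $\alpha_1,\ldots,\alpha_6\in\mathbb N^n$ the integral of the monomial $\bar s^{\alpha_1}s^{\alpha_2}\bar t^{\alpha_3}t^{\alpha_4}\bar u^{\alpha_5}u^{\alpha_6}$ is $$\sum_{\sigma,\mu,\nu}\prod_{k=1}^{k_1}\delta_{\tau_2(\sigma(k))\tau_1(k)}\prod_{k=1}^{k_3}\delta_{\tau_4(\mu(k))\tau_3(k)}\prod_{k=1}^{k_5}\delta_{\tau_6(\nu(k))\tau_5(k)}\in R,$$ where $k_r=|\alpha_r|$, $\tau_r:[k_r]\to[n]$ is any map taking each value $i$ exactly $(\alpha_r)_i$ times, and the sum is over all bijections $\sigma:[k_1]\to[k_2]$, $\mu:[k_3]\to[k_4]$, $\nu:[k_5]\to[k_6]$. The integral of $U\in K$ is the sum over monomials of (coefficient in $U$)$\times$(integral of the monomial), defined when only finitely many terms are nonzero. Pre-Feynman diagram structure on a finite set $E$ (with $I=[1]$, $J=[d]$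 fixed): a tuple $\mathcal E=(E_{\bar s},E_s,E_{\bar t},E_t,E_{\bar u},E_u,E_{int},E_{ext},\pi_F,\pi_G,\rho_s,\rho_{\bar u})$ where the $E_\bullet$ are subsets of $E$; $\pi_F,\pi_G$ are sets of subsets of $E$; $\rho_s:I\to E_{ext}\cap E_s$ and $\rho_{\bar u}:J\to E_{ext}\cap E_{\bar u}$ are bijections; $E_{\bar s},E_s,E_{\bar t},E_t,E_{\bar u},E_u$ are disjoint with union $E$; $E_{int},E_{ext}$ are disjoint with union $E$; $(E_{\bar s}\cup E_{\bar t}\cup E_t\cup E_u)\cap E_{ext}=\emptyset$; $\pi_F\cap\pi_G=\emptyset$ and $\pi_F\cup\pi_G$ is a partition of $E_{int}$; each $B\in\pi_F$ is the union of $B\cap E_{\bar s}$, a singleton, and $B\cap E_t$, nonempty; each $B\in\pi_G$ is the union of $B\cap E_{\bar t}$, a singleton, and $B\cap E_u$, nonempty. Feynman diagram structure on $E$: a quadruple $\mathcal F=(\mathcal E,\mathcal C_s,\mathcal C_t,\mathcal C_u)$ with $\mathcal E$ a pre-Feynman diagram structure on $E$ and bijections $\mathcal C_s:E_{\bar s}\to E_s$, $\mathcal C_t:E_{\bar t}\to E_t$, $\mathcal C_u:E_{\bar u}\to E_u$. A bijection $\sigma:E\to E'$ transports structures: $PreFey(\sigma)(\mathcal E)$ replaces each subset by its image, $\pi_F,\pi_G$ by the sets of images of their blocks, and $\rho_s,\rho_{\bar u}$ by $\sigma\circ\rho_s,\sigma\circ\rho_{\bar u}$; $Fey(\sigma)(\mathcal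 E,\mathcal C_s,\mathcal C_t,\mathcal C_u)=(PreFey(\sigma)(\mathcal E),\sigma\mathcal C_s\sigma^{-1},\sigma\mathcal C_t\sigma^{-1},\sigma\mathcal C_u\sigma^{-1})$ (with appropriate restrictions of $\sigma^{\pm1}$). $Aut(E,\mathcal F)$ is the group of bijections $\sigma:E\to E$ with $Fey(\sigma)(\mathcal F)=\mathcal F$. Amplitude: an index attribution is a map $\alpha:E\to[n]$ with $\alpha|_{E_{ext}\cap E_s}=\tau_s\circ\rho_s^{-1}$ and $\alpha|_{E_{ext}\cap E_{\bar u}}=\tau_{\bar u}\circ\rho_{\bar u}^{-1}$. For $B\in\pi_F$ with $B\cap E_{\bar s}=\{x\}$, $B\cap E_t=\{y_1,\ldots,y_p\}$ let $F(B,\alpha)=F^{[p]}_{\alpha(x),\alpha(y_1)\ldots\alpha(y_p)}$; for $B\in\pi_G$ with $B\cap E_{\bar t}=\{x\}$, $B\cap E_u=\{y_1,\ldots,y_p\}$ let $G(B,\alpha)=G^{[p]}_{\alpha(x),\alpha(y_1)\ldots\alpha(y_p)}$. Then $$\mathcal A_{Fey}(E,\mathcal F,\tau_s,\tau_{\bar u})=\sum_\alpha\prod_{x\in E_{\bar s}}\delta_{\alpha(\mathcal C_s(x))\alpha(x)}\prod_{y\in E_{\bar t}}\delta_{\alpha(\mathcal C_t(y))\alpha(y)}\prod_{z\in E_{\bar u}}\delta_{\alpha(\mathcal C_u(z))\alpha(z)}\prod_{B\in\pi_F}F(B,\alpha)\prod_{B\in\pi_G}G(B,\alpha)\in R,$$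 summed over all index attributions $\alpha$. *)

(* Defs.v *)
From mathcomp Require Import boolp classical_sets cardinality fsbigop.
From mathcomp Require Import all_boot all_order all_algebra all_fingroup.

Set Implicit Arguments.
Unset Strict Implicit.
Unset Printing Implicit Defensive.

Import GRing.Theory.
Local Open Scope ring_scope.

(* Formal power series in the (finitely many) indeterminates V:
   a series is its family of coefficients, indexed by multi-indices. *)

Notation multi_index V := {ffun V -> nat}.

Definition fps (V : finType) (R : Type) : Type := multi_index V -> R.

Section PowerSeries.
Variables (V : finType) (R : comAlgType rat).
Implicit Types (f g : fps V R) (v : V) (m : multi_index V).

Definition fps_const f : R := f [ffun=> 0%N].

Definition fps_one : fps V R := fun m => (m == [ffun=> 0%N])%:R.

Definition fps_var v : fps V R := fun m => (m == [ffun w => nat_of_bool (w == v)])%:R.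

Definition fps_zero : fps V R := fun=> 0.

Definition fps_add f g : fps V R := fun m => f m + g m.

(* Cauchy product: [a] runs over the multi-indices below [m]. *)
Definition fps_mul f g : fps V R := fun m =>
  \sum_(a : {dffun forall v : V, 'I_(m v).+1})
     f [ffun v => nat_of_ord (a v)] * g [ffun v => (m v - a v)%N].

(* [\sum_(k \in A)] is the sum over the [k] giving a nonzero term, when these
   are finitely many (and a default value otherwise). They are finitely many in
   each coefficient when [f] has no constant term. *)
Definition fps_exp f : fps V R := fun m =>
  \sum_(k \in [set: nat]%classic)
     (k`!%:R^-1 : rat) *: iter k (fps_mul f) fps_one m.

Definition fps_deriv v f : fps V R := fun m =>
  f [ffun w => (m w + (w == v))%N] *+ (m v).+1.

(* The iterated partial derivative along the variables listed in [s], at 0. *)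
Definition fps_deriv0 f (s : seq V) : R := fps_const (foldr fps_deriv f s).

End PowerSeries.

(* The 6n indeterminates of K: [(r, k)] is the [k]-th component of the
   [r]-th of the six vectors. *)
Notation gvar n := ('I_6 * 'I_n)%type.
Notation v_sbar := (@Ordinal 6 0 isT).
Notation v_s    := (@Ordinal 6 1 isT).
Notation v_tbar := (@Ordinal 6 2 isT).
Notation v_t    := (@Ordinal 6 3 isT).
Notation v_ubar := (@Ordinal 6 4 isT).
Notation v_u    := (@Ordinal 6 5 isT).

Section GaussianIntegral.
Variables (n : nat) (R : comAlgType rat).

(* [f] with the [r]-th vector of indeterminates substituted for X. *)
Definition fps_in (r : 'I_6) (f : fps 'I_n R) : fps (gvar n) R := fun m =>
  if [forall v : gvar n, (v.1 != r) ==> (m v == 0%N)]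
  then f [ffun k => m (r, k)] else 0.

(* \sum_k x_k H_k(y), for [x], [y] the [r]-th and [r']-th vectors. *)
Definition fps_pairing (r r' : 'I_6) (H : 'I_n -> fps 'I_n R) : fps (gvar n) R :=
  \big[@fps_add _ R / @fps_zero _ R]_(k < n)
     fps_mul (fps_var R (r, k)) (fps_in r' (H k)).

Section Monomial.
Variable m : multi_index (gvar n).

(* [tau r : [k_r] -> [n]] takes the value [i] exactly [m (r, i)] times, namely
   as the weakly increasing sequence with these multiplicities. *)
Definition tau_seq (r : 'I_6) : seq 'I_n :=
  flatten [seq nseq (m (r, i)) i | i <- enum 'I_n].

Definition mon_deg (r : 'I_6) : nat := size (tau_seq r).

Definition tau (r : 'I_6) : 'I_(mon_deg r) -> 'I_n := tnth (in_tuple (tau_seq r)).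

Definition bijectiveb (p q : nat) (f : {ffun 'I_p -> 'I_q}) : bool :=
  injectiveb f && [forall y, y \in codom f].

Definition mon_integral : R :=
  \sum_(sg : {ffun 'I_(mon_deg v_sbar) -> 'I_(mon_deg v_s)} | bijectiveb sg)
  \sum_(mu : {ffun 'I_(mon_deg v_tbar) -> 'I_(mon_deg v_t)} | bijectiveb mu)
  \sum_(nu : {ffun 'I_(mon_deg v_ubar) -> 'I_(mon_deg v_u)} | bijectiveb nu)
     (\prod_k (tau (sg k) == tau k)%:R) *
     (\prod_k (tau (mu k) == tau k)%:R) *
     (\prod_k (tau (nu k) == tau k)%:R).

End Monomial.

Definition gauss_integrable (U : fps (gvar n) R) : Prop :=
  finite_set [set m : multi_index (gvar n) | U m * mon_integral m != 0]%classic.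

(* The integral against e^(- sbar s - tbar t - ubar u). *)
Definition gauss_integral (U : fps (gvar n) R) : R :=
  \sum_(m \in [set: multi_index (gvar n)]%classic) U m * mon_integral m.

End GaussianIntegral.

Section Diagrams.
Variable d : nat.

Record prefey (E : finType) := PreFey {
  E_sbar : {set E}; E_s : {set E};
  E_tbar : {set E}; E_t : {set E};
  E_ubar : {set E}; E_u : {set E};
  E_int : {set E}; E_ext : {set E};
  pi_F : {set {set E}}; pi_G : {set {set E}};
  rho_s : {ffun 'I_1 -> E};
  rho_ubar : {ffun 'I_d -> E} }.

Definition is_bij_onto (T E : finType) (f : T -> E) (A : {set T}) (B : {set E}) : Prop :=
  {in A &, injective f} /\ f @: A = B.

Record is_prefey (E : finType) (P : prefey E) : Prop := IsPreFey {
  prefey_rho_s : is_bij_onto (rho_s P) [set: 'I_1] (E_ext P :&: E_s P);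
  prefey_rho_ubar : is_bij_onto (rho_ubar P) [set: 'I_d] (E_ext P :&: E_ubar P);
  prefey_disj6 : pairwise (fun A B : {set E} => [disjoint A & B])
    [:: E_sbar P; E_s P; E_tbar P; E_t P; E_ubar P; E_u P];
  prefey_cover6 : E_sbar P :|: E_s P :|: E_tbar P :|: E_t P :|: E_ubar P :|: E_u P
    = [set: E];
  prefey_disj2 : [disjoint E_int P & E_ext P];
  prefey_cover2 : E_int P :|: E_ext P = [set: E];
  prefey_ext : (E_sbar P :|: E_tbar P :|: E_t P :|: E_u P) :&: E_ext P = set0;
  prefey_disj_pi : [disjoint pi_F P & pi_G P];
  prefey_part : partition (pi_F P :|: pi_G P) (E_int P);
  prefey_F : forall B, B \in pi_F P ->
    [/\ B = (B :&: E_sbar P) :|: (B :&: E_t P),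
        #|B :&: E_sbar P| = 1%N & B :&: E_t P != set0];
  prefey_G : forall B, B \in pi_G P ->
    [/\ B = (B :&: E_tbar P) :|: (B :&: E_u P),
        #|B :&: E_tbar P| = 1%N & B :&: E_u P != set0] }.

(* The contractions are maps on [E] of which only the restrictions to
   E_sbar, E_tbar, E_ubar are meaningful: no definition below depends on
   their values elsewhere. *)
Record fey (E : finType) := Fey {
  fey_pre :> prefey E;
  C_s : {ffun E -> E};
  C_t : {ffun E -> E};
  C_u : {ffun E -> E} }.

Definition is_fey (E : finType) (F : fey E) : Prop :=
  [/\ is_prefey F,
      is_bij_onto (C_s F) (E_sbar F) (E_s F),
      is_bij_onto (C_t F) (E_tbar F) (E_t F) &
      is_bij_onto (C_u F) (E_ubar F) (E_u F)].

Definition prefey_map (E E' : finType) (sg : E -> E') (P : prefey E) : prefey E' :=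
  let im (A : {set E}) := sg @: A in
  PreFey (im (E_sbar P)) (im (E_s P)) (im (E_tbar P)) (im (E_t P))
         (im (E_ubar P)) (im (E_u P)) (im (E_int P)) (im (E_ext P))
         [set im B | B in pi_F P] [set im B | B in pi_G P]
         [ffun k => sg (rho_s P k)] [ffun k => sg (rho_ubar P k)].

(* Fey(sg)(F) = F', for a bijection [sg]; C' = sg C sg^-1 is tested on the
   domain of C. *)
Definition fey_transports (E E' : finType) (sg : E -> E') (F : fey E) (F' : fey E') : Prop :=
  [/\ prefey_map sg F = fey_pre F',
      {in E_sbar F, forall x, C_s F' (sg x) = sg (C_s F x)},
      {in E_tbar F, forall x, C_t F' (sg x) = sg (C_t F x)} &
      {in E_ubar F, forall x, C_u F' (sg x) = sg (C_u F x)}].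

Definition fey_aut (E : finType) (F : fey E) : {set {perm E}} :=
  [set sg : {perm E} | `[< fey_transports sg F F >]].

Record diagram := Diagram {
  dia_set : finType;
  dia_fey : fey dia_set;
  dia_valid : is_fey dia_fey }.

Definition dia_equiv (D D' : diagram) : Prop :=
  exists2 sg : dia_set D -> dia_set D',
    bijective sg & fey_transports sg (dia_fey D) (dia_fey D').

(* [rep] picks exactly one representative in each equivalence class. *)
Definition dia_transversal (N : nat) (rep : 'I_N -> diagram) : Prop :=
  forall D : diagram, exists! k : 'I_N, dia_equiv D (rep k).

End Diagrams.

Section Amplitude.
Variables (n d : nat) (R : comAlgType rat).
Variables (F G : 'I_n -> fps 'I_n R).
Variables (tau_s : 'I_1 -> 'I_n) (tau_ubar : 'I_d -> 'I_n).

(* [X] and [Y] are the two parts of a block; [X] is a singleton, so that the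
   product has a single factor. *)
Definition vertex_weight (H : 'I_n -> fps 'I_n R) (E : finType)
    (al : E -> 'I_n) (X Y : {set E}) : R :=
  \prod_(x in X) fps_deriv0 (H (al x)) [seq al y | y <- enum Y].

Definition index_attribution (E : finType) (P : prefey d E) (al : {ffun E -> 'I_n}) : bool :=
  [forall k, al (rho_s P k) == tau_s k] && [forall k, al (rho_ubar P k) == tau_ubar k].

Definition amplitude (E : finType) (D : fey d E) : R :=
  \sum_(al : {ffun E -> 'I_n} | index_attribution D al)
     (\prod_(x in E_sbar D) (al (C_s D x) == al x)%:R) *
     (\prod_(y in E_tbar D) (al (C_t D y) == al y)%:R) *
     (\prod_(z in E_ubar D) (al (C_u D z) == al z)%:R) *
     (\prod_(B in pi_F D) vertex_weight F al (B :&: E_sbar D) (B :&: E_t D)) *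
     (\prod_(B in pi_G D) vertex_weight G al (B :&: E_tbar D) (B :&: E_u D)).

End Amplitude.

(* Main.v *)
(* Both sides are the Faa di Bruno expansion of d_{j_1} ... d_{j_d} (F_i o G) at 0.

   Integral: d/dsbar_i exp(sbar F(t) + tbar G(u)) = F_i(t) exp(...) and
   d/dtbar_k exp(...) = G_k(u) exp(...), so the coefficient of
   sbar_i tbar^b t^b u^c in the exponential, times b!, is [X^b]F_i [X^c]G^b. The
   Gaussian integral of a monomial only matches exponents and contributes b! c!,
   where c counts the indices j; summing over b gives c! [X^c](F_i o G).

   Diagrams: the external labels rho_ubar transfer along the contractions C_u
   and the blocks of pi_G to everything else, so automorphisms are trivial, and
   a diagram is determined up to equivalence by the set partition of {1..d}
   that pi_G cuts out on the legs. The amplitude of the diagram of a partition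
   is the corresponding Faa di Bruno term. *)

From HB Require Import structures.
Require Import Defs.
From mathcomp Require Import boolp classical_sets cardinality fsbigop.
From mathcomp Require Import all_boot all_order all_algebra all_fingroup.
From mathcomp Require Import zify.

Set Implicit Arguments.
Unset Strict Implicit.
Unset Printing Implicit Defensive.

Import GRing.Theory.
Local Open Scope ring_scope.

(** * Multi-indices and the ring of power series *)

(** Identities between series are proved through derivatives: over a Q-algebra a coefficient at a
    nonzero multi-index is, up to a positive integer factor, a coefficient of a partial derivative.
    The ring laws, substitution and the exponential thus reduce to Leibniz and chain rules instead
    of multinomial sums. Both sides meet at the derivative at 0 of [F i] composed with [G] along the
    set of labels ['I_d], the label [nu] acting in direction [j nu]. Working with labels rather than
    multi-indices lets set partitions appear without multiplicities even when [j] repeats a value.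
    There is a single [F] vertex for a combinatorial reason: blocks contain no element of [E_s], so
    [E_s] is external and reduced to the root by [rho_s]; then [C_s] leaves one element in
    [E_sbar]. *)

Section MultiIndex.
Variable V : finType.
Implicit Types (m a b : multi_index V) (v : V).

Definition mi_zero : multi_index V := [ffun=> 0%N].
Definition mi_unit v : multi_index V := [ffun w => nat_of_bool (w == v)].
Definition mi_add a b : multi_index V := [ffun w => (a w + b w)%N].
Definition mi_sub a b : multi_index V := [ffun w => (a w - b w)%N].
Definition mi_le a b : bool := [forall w, a w <= b w]%N.
Definition mi_deg m : nat := (\sum_v m v)%N.
(** The index set of the Cauchy product as a duplicate-free sequence of one fixed type: sums over
    boxes of different sizes can then be compared by [uniq_perm], which dependent function types
    varying with [m] would not allow. *)
Definition mi_box m : seq (multi_index V) :=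
  [seq [ffun v => nat_of_ord (a v)] | a : {dffun forall v : V, 'I_(m v).+1}].

Lemma mi_leP a b : reflect (forall w, a w <= b w)%N (mi_le a b).
Proof. exact: forallP. Qed.

Lemma mi_box_uniq m : uniq (mi_box m).
Proof.
rewrite map_inj_uniq ?enum_uniq // => a b /ffunP ab.
by apply/ffunP => v; apply: val_inj; have := ab v; rewrite !ffunE.
Qed.

Lemma mem_mi_box m a : (a \in mi_box m) = mi_le a m.
Proof.
apply/mapP/mi_leP => [[b _ ->] w | am]; first by rewrite ffunE -ltnS.
pose b : {dffun forall v : V, 'I_(m v).+1} :=
  [ffun v => Ordinal (am v : a v < (m v).+1)%N].
by exists b; rewrite ?mem_enum //; apply/ffunP => v; rewrite !ffunE.
Qed.

Lemma mi_unitE v w : mi_unit v w = (w == v). Proof. by rewrite ffunE. Qed.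

Lemma mi_deg_unit v : mi_deg (mi_unit v) = 1%N.
Proof.
rewrite /mi_deg (bigD1 v) //= mi_unitE eqxx big1 // => w.
by rewrite mi_unitE => /negPf->.
Qed.

Lemma mi_degD a b : mi_deg (mi_add a b) = (mi_deg a + mi_deg b)%N.
Proof. by rewrite /mi_deg -big_split; apply: eq_bigr => v _; rewrite ffunE. Qed.

Lemma mi_deg_eq0 m : mi_deg m = 0%N -> m = mi_zero.
Proof.
move=> m0; apply/ffunP => v; rewrite ffunE; apply/eqP.
by have := sum_nat_eq0 predT m; rewrite [X in X == _]m0 eqxx => /esym/forallP/(_ v).
Qed.

Lemma leq_mi_deg m v : (m v <= mi_deg m)%N.
Proof. by rewrite /mi_deg (bigD1 v) //= leq_addr. Qed.

Lemma mi_subK a m : mi_le a m -> mi_add (mi_sub m a) a = m.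
Proof. by move/mi_leP=> am; apply/ffunP => v; rewrite !ffunE subnK. Qed.

Lemma mi_addK a m : mi_sub (mi_add m a) a = m.
Proof. by apply/ffunP => v; rewrite !ffunE addnK. Qed.

Lemma mi_addC a b : mi_add a b = mi_add b a.
Proof. by apply/ffunP => v; rewrite !ffunE addnC. Qed.

Lemma mi_addA a b c : mi_add a (mi_add b c) = mi_add (mi_add a b) c.
Proof. by apply/ffunP => v; rewrite !ffunE addnA. Qed.

Lemma mi_unit_le v m : mi_le (mi_unit v) m = (0 < m v)%N.
Proof.
apply/mi_leP/idP => [/(_ v) | mv w]; rewrite mi_unitE ?eqxx //.
by case: eqP => // ->.
Qed.

(** Induction on the degree, since a nonzero multi-index has a positive entry to remove. The step
    has the form in which [fps_deriv] shifts coefficients. *)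
Lemma mi_ind (Q : multi_index V -> Prop) :
  Q mi_zero -> (forall m v, Q m -> Q (mi_add m (mi_unit v))) -> forall m, Q m.
Proof.
move=> Q0 Q1 m; move: {2}(mi_deg m) (erefl (mi_deg m)) => N.
elim: N m => [|N IHN] m dm; first by rewrite (mi_deg_eq0 dm).
have [v mv] : exists v, (0 < m v)%N.
  apply/existsP; apply: contra_eqT dm => /existsPn m0.
  by rewrite /mi_deg big1 // => v _; apply/eqP; rewrite -leqn0 leqNgt.
have um : mi_le (mi_unit v) m by rewrite mi_unit_le.
rewrite -(mi_subK um); apply/Q1/IHN.
by have := mi_degD (mi_sub m (mi_unit v)) (mi_unit v); rewrite mi_subK // mi_deg_unit dm; lia.
Qed.

Lemma mi_box0 : mi_box mi_zero = [:: mi_zero].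
Proof.
apply: perm_small_eq => //; apply: uniq_perm; rewrite ?mi_box_uniq // => a.
rewrite mem_mi_box inE; apply/mi_leP/eqP => [a0 | -> //].
by apply/ffunP => v; have := a0 v; rewrite !ffunE leqn0 => /eqP.
Qed.

(* The factor [a v] kills the boundary terms of the shift. *)
Lemma mi_box_shift (M : nmodType) m v (g : multi_index V -> M) :
  \sum_(a <- mi_box (mi_add m (mi_unit v))) g a *+ a v =
  \sum_(a <- mi_box m) g (mi_add a (mi_unit v)) *+ (a v).+1.
Proof.
rewrite (bigID (fun a : multi_index V => a v == 0%N)) /= big1 ?add0r; last first.
  by move=> a /eqP->.
rewrite -big_filter.
have -> : \sum_(a <- mi_box m) g (mi_add a (mi_unit v)) *+ (a v).+1 =
    \sum_(a <- [seq mi_add a (mi_unit v) | a <- mi_box m]) g a *+ a v.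
  by rewrite [RHS]big_map; apply: eq_bigr => a _; rewrite !ffunE eqxx addn1.
apply/perm_big/uniq_perm.
- exact/filter_uniq/mi_box_uniq.
- by rewrite map_inj_uniq ?mi_box_uniq // => a b ab; rewrite -(mi_addK (mi_unit v) a) ab mi_addK.
move=> a; rewrite mem_filter mem_mi_box; apply/andP/mapP => [[av am] | [b]].
  have ua : mi_le (mi_unit v) a by rewrite mi_unit_le lt0n.
  exists (mi_sub a (mi_unit v)); last by rewrite mi_subK.
  rewrite mem_mi_box; apply/mi_leP => w; move/mi_leP: am => /(_ w).
  by rewrite !ffunE leq_subLR addnC.
rewrite mem_mi_box => /mi_leP bm ->; rewrite !ffunE eqxx addn1; split=> //.
by apply/mi_leP => w; rewrite !ffunE leq_add2r.
Qed.

End MultiIndex.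
Arguments mi_zero {V}.

Lemma mulrn_injQ (R : comAlgType rat) (k : nat) (x y : R) :
  (0 < k)%N -> x *+ k = y *+ k -> x = y.
Proof.
move=> k0 /(congr1 ( *:%R ((k%:R : rat)^-1))).
by rewrite -!scaler_nat !scalerA mulVf ?scale1r // Num.Theory.pnatr_eq0 -lt0n.
Qed.

Section FpsRing.
Variables (V : finType) (R : comAlgType rat).
Implicit Types (f g h : fps V R) (v w : V) (m a b : multi_index V).

Lemma fps_mulE f g m : fps_mul f g m = \sum_(a <- mi_box m) f a * g (mi_sub m a).
Proof.
rewrite big_map big_enum; apply: eq_bigr => a _; congr (_ * g _).
by apply/ffunP => v; rewrite !ffunE.
Qed.

Lemma fps_derivE v f m : fps_deriv v f m = f (mi_add m (mi_unit v)) *+ (m v).+1.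
Proof. by congr (f _ *+ _); apply/ffunP => w; rewrite !ffunE. Qed.

Lemma fps_const_mul f g : fps_const (fps_mul f g) = fps_const f * fps_const g.
Proof.
rewrite /fps_const fps_mulE mi_box0 big_seq1; congr (_ * g _).
by apply/ffunP => v; rewrite !ffunE.
Qed.

Lemma fps_deriv_mul v f g :
  fps_deriv v (fps_mul f g) =
  fps_add (fps_mul (fps_deriv v f) g) (fps_mul f (fps_deriv v g)).
Proof.
apply/funext => m; rewrite /fps_add fps_derivE !fps_mulE.
set m' := mi_add m (mi_unit v).
(* For [a] in the box of [m'], the numbers [a v] and [(m' - a) v] add up to [m v + 1]; distributing
   this factor separates the derivative of [f] from that of [g]. *)
have -> : (\sum_(a <- mi_box m') f a * g (mi_sub m' a)) *+ (m v).+1 =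
    \sum_(a <- mi_box m') (f a * g (mi_sub m' a)) *+ a v +
    \sum_(a <- mi_box m') (f a * g (mi_sub m' a)) *+ (mi_sub m' a v).
  rewrite -big_split /= -sumrMnl; apply: eq_big_seq => a.
  rewrite mem_mi_box => /mi_leP/(_ v); rewrite -mulrnDr !ffunE eqxx addn1 => av.
  by rewrite subnKC.
congr (_ + _).
  rewrite (mi_box_shift _ _ (fun a => f a * g (mi_sub m' a))).
  apply: eq_bigr => a _; rewrite fps_derivE mulrnAl.
  by congr (_ * g _ *+ _); apply/ffunP => w; rewrite !ffunE subnDr.
(* An index below [m'] but not below [m] has [a v = m v + 1], so its factor [(m' - a) v] vanishes;
   what remains is the box of [m]. *)
rewrite (bigID (fun a => mi_le a m)) /= [X in _ + X]big1_seq ?addr0; last first.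
  move=> a /andP[am]; rewrite mem_mi_box => /mi_leP am'.
  rewrite (_ : mi_sub m' a v = 0%N) ?mulr0n //.
  have [w] := forallPn am; rewrite -ltnNge => aw; have := am' w.
  rewrite !ffunE; case: eqP aw => [-> | _]; rewrite ?eqxx /=; lia.
rewrite -big_filter; have -> : \sum_(a <- [seq a <- mi_box m' | mi_le a m])
    (f a * g (mi_sub m' a)) *+ mi_sub m' a v =
  \sum_(a <- mi_box m) (f a * g (mi_sub m' a)) *+ mi_sub m' a v.
  apply/perm_big/uniq_perm; rewrite ?filter_uniq ?mi_box_uniq // => a.
  rewrite mem_filter !mem_mi_box andb_idr // => /mi_leP am.
  by apply/mi_leP => w; rewrite ffunE; apply: leq_trans (am w) (leq_addr _ _).
apply: eq_big_seq => a; rewrite mem_mi_box => /mi_leP am.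
rewrite fps_derivE mulrnAr; have := am v => av.
rewrite (_ : mi_add (mi_sub m a) (mi_unit v) = mi_sub m' a); last first.
  by apply/ffunP => w; rewrite !ffunE; have := am w; lia.
by rewrite !ffunE eqxx; congr (_ *+ _); lia.
Qed.

(* Over a Q-algebra the derivatives determine every non-constant coefficient, so
   the ring laws follow from the Leibniz rule by induction on the multi-index. *)
Lemma fps_eq_step v f g m :
  fps_deriv v f m = fps_deriv v g m ->
  f (mi_add m (mi_unit v)) = g (mi_add m (mi_unit v)).
Proof. by rewrite !fps_derivE => /mulrn_injQ ->. Qed.

Lemma fps_deriv_add v f g :
  fps_deriv v (fps_add f g) = fps_add (fps_deriv v f) (fps_deriv v g).
Proof. by apply/funext => m; rewrite /fps_add !fps_derivE mulrnDl. Qed.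

Lemma fps_mulDl f g h : fps_mul (fps_add f g) h = fps_add (fps_mul f h) (fps_mul g h).
Proof.
apply/funext => m; rewrite /fps_add !fps_mulE -big_split.
by apply: eq_bigr => a _; rewrite mulrDl.
Qed.

Lemma fps_mulC f g : fps_mul f g = fps_mul g f.
Proof.
apply/funext => m; elim/mi_ind: m f g => [|m v IHm] f g.
  by have := fps_const_mul f g; rewrite mulrC -fps_const_mul.
by apply: fps_eq_step; rewrite !fps_deriv_mul /fps_add addrC; congr (_ + _); apply: IHm.
Qed.

Lemma fps_mulDr f g h : fps_mul f (fps_add g h) = fps_add (fps_mul f g) (fps_mul f h).
Proof. by rewrite fps_mulC fps_mulDl !(fps_mulC f). Qed.

Lemma fps_mulA f g h : fps_mul f (fps_mul g h) = fps_mul (fps_mul f g) h.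
Proof.
apply/funext => m; elim/mi_ind: m f g h => [|m v IHm] f g h.
  have : fps_const (fps_mul f (fps_mul g h)) = fps_const (fps_mul (fps_mul f g) h).
    by rewrite !fps_const_mul mulrA.
  by [].
apply: fps_eq_step; rewrite !fps_deriv_mul fps_mulDl fps_mulDr /fps_add.
by rewrite !IHm addrA.
Qed.

Lemma fps_deriv_one v : fps_deriv v (@fps_one V R) = @fps_zero V R.
Proof.
apply/funext => m; rewrite fps_derivE /fps_one.
case: eqP => [/ffunP/(_ v)|]; last by rewrite mul0rn.
by rewrite !ffunE eqxx addn1.
Qed.

Lemma fps_mul0 f : fps_mul (@fps_zero V R) f = @fps_zero V R.
Proof. by apply/funext => m; rewrite fps_mulE big1 // => a _; rewrite mul0r. Qed.

Lemma fps_mul1 f : fps_mul (@fps_one V R) f = f.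
Proof.
apply/funext => m; elim/mi_ind: m f => [|m v IHm] f.
  by have := fps_const_mul (@fps_one V R) f; rewrite /fps_const /fps_one eqxx mul1r.
apply: fps_eq_step; rewrite fps_deriv_mul fps_deriv_one fps_mul0 /fps_add IHm.
exact: add0r.
Qed.

Definition fps_opp f : fps V R := fun m => - f m.

Fact fps_addA : associative (@fps_add V R).
Proof. by move=> f g h; apply/funext => m; apply: addrA. Qed.

Fact fps_addC : commutative (@fps_add V R).
Proof. by move=> f g; apply/funext => m; apply: addrC. Qed.

Fact fps_add0 : left_id (@fps_zero V R) (@fps_add V R).
Proof. by move=> f; apply/funext => m; apply: add0r. Qed.

Fact fps_addN : left_inverse (@fps_zero V R) fps_opp (@fps_add V R).
Proof. by move=> f; apply/funext => m; apply: addNr. Qed.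

(** Equality of series is decided classically. The ring operations are [fps_add] and [fps_mul]
    themselves, so these, and big operators built on them, convert to ring notation. *)
HB.instance Definition _ := gen_eqMixin (fps V R).
HB.instance Definition _ := gen_choiceMixin (fps V R).
HB.instance Definition _ :=
  GRing.isZmodule.Build (fps V R) fps_addA fps_addC fps_add0 fps_addN.

Fact fps_oner_neq0 : @fps_one V R != 0.
Proof.
apply/eqP => /(congr1 (fun f : fps V R => f [ffun=> 0%N])).
by rewrite /fps_one eqxx; apply/eqP/oner_neq0.
Qed.

HB.instance Definition _ :=
  GRing.Zmodule_isComNzRing.Build (fps V R)
    fps_mulA fps_mulC fps_mul1 fps_mulDl fps_oner_neq0.

End FpsRing.

(** * Calculus of power series *)

Section FpsCalculus.
Variables (V : finType) (R : comAlgType rat).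
Implicit Types (f g h : fps V R) (v w : V) (m a b : multi_index V).

Lemma fps_coefD f g m : (f + g) m = f m + g m.
Proof. by []. Qed.

Lemma fps_coef0 m : (0 : fps V R) m = 0.
Proof. by []. Qed.

Lemma fps_coef_sum (I : Type) (r : seq I) (P : pred I) (F : I -> fps V R) m :
  (\sum_(i <- r | P i) F i) m = \sum_(i <- r | P i) F i m.
Proof. exact: (big_morph (fun f : fps V R => f m) (fun f g => fps_coefD f g m) (fps_coef0 m)). Qed.

Lemma fps_coefMn f k m : (f *+ k) m = f m *+ k.
Proof. by elim: k => // k IHk; rewrite !mulrS fps_coefD IHk. Qed.

Lemma fps_coefM f g m : (f * g) m = \sum_(a <- mi_box m) f a * g (mi_sub m a).
Proof. exact: fps_mulE. Qed.

Lemma fps_derivD v f g : fps_deriv v (f + g) = fps_deriv v f + fps_deriv v g.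
Proof. exact: fps_deriv_add. Qed.

Lemma fps_derivM v f g : fps_deriv v (f * g) = fps_deriv v f * g + f * fps_deriv v g.
Proof. exact: fps_deriv_mul. Qed.

Lemma fps_deriv1 v : fps_deriv v (1 : fps V R) = 0.
Proof. exact: fps_deriv_one. Qed.

Lemma fps_deriv_zero v : fps_deriv v (0 : fps V R) = 0.
Proof. by apply/funext => m; rewrite fps_derivE fps_coef0 mul0rn. Qed.

Lemma fps_deriv_sum v (I : Type) (r : seq I) (P : pred I) (F : I -> fps V R) :
  fps_deriv v (\sum_(i <- r | P i) F i) = \sum_(i <- r | P i) fps_deriv v (F i).
Proof. exact: (big_morph (fps_deriv v) (fps_derivD v) (fps_deriv_zero v)). Qed.

Lemma fps_derivX v f k : fps_deriv v (f ^+ k.+1) = fps_deriv v f * f ^+ k *+ k.+1.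
Proof.
elim: k => [|k IHk]; first by rewrite !expr1 expr0 mulr1 mulr1n.
rewrite exprS fps_derivM IHk mulrnAr mulrCA -exprS.
by rewrite -mulrS.
Qed.

Lemma fps_derivC v w f : fps_deriv v (fps_deriv w f) = fps_deriv w (fps_deriv v f).
Proof.
apply/funext => m; rewrite !fps_derivE -!mi_addA (mi_addC (mi_unit w)) -!mulrnA.
by congr (_ *+ _); rewrite !ffunE (eq_sym v); case: eqP => [->|_]; rewrite ?addn1 ?addn0 // mulnC.
Qed.

Lemma fps_constD f g : fps_const (f + g) = fps_const f + fps_const g.
Proof. by []. Qed.

Lemma fps_constM f g : fps_const (f * g) = fps_const f * fps_const g.
Proof. exact: fps_const_mul. Qed.

Lemma fps_const1 : fps_const (1 : fps V R) = 1.
Proof. by change (@fps_one V R [ffun=> 0%N] = 1); rewrite /fps_one eqxx. Qed.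

Lemma fps_iter_mul f k : iter k (fps_mul f) (@fps_one V R) = f ^+ k.
Proof. by elim: k => //= k ->; rewrite exprS. Qed.

Lemma fps_coefX_eq0 f k m : fps_const f = 0 -> (mi_deg m < k)%N -> (f ^+ k) m = 0.
Proof.
move=> f0; elim: k m => // k IHk m mk.
rewrite exprS fps_coefM big1_seq // => a /=; rewrite mem_mi_box => am.
have [/mi_deg_eq0-> | a0] := eqVneq (mi_deg a) 0%N; first by rewrite [f _]f0 mul0r.
rewrite IHk ?mulr0 //; have := mi_degD (mi_sub m a) a; rewrite mi_subK //; lia.
Qed.

(** The powers beyond the degree of [m] vanish there. The bound [N] is free so that one truncation
    serves [m] and all multi-indices below it. *)
Lemma fps_expE f N m : fps_const f = 0 -> (mi_deg m < N)%N ->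
  fps_exp f m = \sum_(k < N) (k`!%:R^-1 : rat) *: (f ^+ k) m.
Proof.
move=> f0 mN; rewrite /fps_exp (fsbigE (index_iota 0 N)) ?iota_uniq //.
  under eq_bigl do rewrite classical_sets.in_setT.
  by rewrite big_mkord; under eq_bigr do rewrite fps_iter_mul.
move=> k _; rewrite mem_index_iota /= -leqNgt => Nk.
by rewrite fps_iter_mul fps_coefX_eq0 ?scaler0 // (leq_trans mN).
Qed.

Lemma fps_deriv_exp v f : fps_const f = 0 ->
  fps_deriv v (fps_exp f) = fps_deriv v f * fps_exp f.
Proof.
move=> f0; apply/funext => m; rewrite fps_derivE.
pose N := (mi_deg m).+1.
(* Differentiation lowers the power by one: [N + 1] terms are kept before it and [N] after it. The
   term of power 0 drops out, and [(k + 1) / (k + 1)!] is [1 / k!]. *)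
rewrite (@fps_expE _ N.+1) ?mi_degD ?mi_deg_unit //; last by rewrite /N; lia.
transitivity (\sum_(k < N.+1) (k`!%:R^-1 : rat) *: (fps_deriv v (f ^+ k)) m).
  by rewrite -sumrMnl; apply: eq_bigr => k _; rewrite fps_derivE scalerMnr.
rewrite big_ord_recl expr0 fps_deriv1 fps_coef0 scaler0 add0r fps_coefM.
transitivity (\sum_(k < N) (k`!%:R^-1 : rat) *: (fps_deriv v f * f ^+ k) m).
  apply: eq_bigr => k _; rewrite fps_derivX fps_coefMn -scalerMnr scalerMnl factS natrM invfM.
  by rewrite mulrC -mulr_natr -mulrA mulVf ?mulr1 // Num.Theory.pnatr_eq0.
under eq_bigr do rewrite fps_coefM scaler_sumr.
rewrite exchange_big; apply: eq_big_seq => a /=; rewrite mem_mi_box => am.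
rewrite (@fps_expE _ N) //; last first.
  by rewrite /N ltnS -{2}(mi_subK am) mi_degD leq_addr.
by rewrite mulr_sumr; apply: eq_bigr => k _; rewrite scalerAr.
Qed.

Lemma fps_coef_var v m : fps_var R v m = (m == mi_unit v)%:R.
Proof. by []. Qed.

Lemma fps_deriv_var v w : fps_deriv v (fps_var R w : fps V R) = (v == w)%:R.
Proof.
apply/funext => m; rewrite fps_derivE fps_coef_var.
have [<-|vw] := eqVneq v w.
  change ((mi_add m (mi_unit v) == mi_unit v)%:R *+ (m v).+1 = (m == [ffun=> 0%N])%:R :> R).
  have -> : (mi_add m (mi_unit v) == mi_unit v) = (m == [ffun=> 0%N]).
    apply/eqP/eqP => [E | ->].
      by apply/ffunP => u; move/ffunP/(_ u): E; rewrite !ffunE; case: (u == v) => /= E'; lia.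
    by apply/ffunP => u; rewrite !ffunE.
  by case: eqP => [->|_]; rewrite ?ffunE ?mul0rn.
case: eqP => [/ffunP/(_ v)|_]; last by rewrite mul0rn.
by rewrite !ffunE eqxx (negPf vw) addn1.
Qed.

Lemma fps_coef_varM v f m :
  (fps_var R v * f) m = if (0 < m v)%N then f (mi_sub m (mi_unit v)) else 0.
Proof.
rewrite fps_coefM; case: ifP => mv.
  rewrite (bigD1_seq (mi_unit v)) ?mi_box_uniq ?mem_mi_box ?mi_unit_le //=.
  rewrite fps_coef_var eqxx mul1r big1 ?addr0 // => a /negPf av.
  by rewrite fps_coef_var av mul0r.
rewrite big1_seq // => a /=; rewrite mem_mi_box fps_coef_var.
by case: eqP => [->|_]; rewrite ?mul0r // mi_unit_le mv.
Qed.

Definition mi_of_seq (s : seq V) : multi_index V := [ffun v => count_mem v s].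
Definition mi_fact m : nat := (\prod_v (m v)`!)%N.

Lemma foldr_deriv_comm v f s :
  foldr (@fps_deriv V R) (fps_deriv v f) s = fps_deriv v (foldr (@fps_deriv V R) f s).
Proof. by elim: s => //= w s ->; rewrite fps_derivC. Qed.

Lemma fps_deriv0_cons f v s : fps_deriv0 f (v :: s) = fps_deriv0 (fps_deriv v f) s.
Proof. by rewrite /fps_deriv0 foldr_deriv_comm. Qed.

Lemma mi_fact_unit m v : mi_fact (mi_add m (mi_unit v)) = (mi_fact m * (m v).+1)%N.
Proof.
rewrite /mi_fact (bigD1 v) //= [in RHS](bigD1 v) //= !ffunE eqxx addn1 factS.
rewrite (eq_bigr (fun w => (m w)`!)); first by rewrite -mulnA mulnC.
by move=> w /negPf wv; rewrite !ffunE wv addn0.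
Qed.

Lemma fps_deriv0E f s : fps_deriv0 f s = f (mi_of_seq s) *+ mi_fact (mi_of_seq s).
Proof.
elim: s f => [|v s IHs] f.
  rewrite (_ : mi_of_seq [::] = mi_zero); last by apply/ffunP => v; rewrite !ffunE.
  by rewrite /mi_fact big1 // => v _; rewrite ffunE.
rewrite fps_deriv0_cons IHs fps_derivE -mulrnA.
have -> : mi_of_seq (v :: s) = mi_add (mi_of_seq s) (mi_unit v).
  by apply/ffunP => w; rewrite !ffunE /= addnC eq_sym.
by rewrite mi_fact_unit mulnC.
Qed.

Lemma fps_coef_prod_varM s f m :
  ((\prod_(v <- s) fps_var R v : fps V R) * f) m =
  if mi_le (mi_of_seq s) m then f (mi_sub m (mi_of_seq s)) else 0.
Proof.
elim: s m => [|v s IHs] m.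
  rewrite big_nil mul1r ifT; last by apply/mi_leP => w; rewrite ffunE.
  by congr f; apply/ffunP => w; rewrite !ffunE subn0.
rewrite big_cons -mulrA fps_coef_varM IHs.
have sE w : mi_of_seq (v :: s) w = ((v == w) + mi_of_seq s w)%N by rewrite !ffunE.
case: (posnP (m v)) => mv /=.
  rewrite ifF //; apply/mi_leP => /(_ v).
  by rewrite sE eqxx mv.
rewrite (_ : mi_le _ _ = mi_le (mi_of_seq (v :: s)) m); last first.
  apply/mi_leP/mi_leP => sm w; have := sm w; rewrite sE [mi_sub _ _ w]ffunE mi_unitE eq_sym;
  by case: eqP => [vw|_] /=; rewrite ?subn0 //; move: mv; rewrite vw; lia.
case: ifP => // _; congr f; apply/ffunP => w.
by rewrite [RHS]ffunE [LHS]ffunE [mi_sub m _ w]ffunE sE mi_unitE eq_sym subnDA.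
Qed.

Lemma fps_deriv0_perm f s t : perm_eq s t -> fps_deriv0 f s = fps_deriv0 f t.
Proof.
move=> /seq.permP st; rewrite !fps_deriv0E (_ : mi_of_seq s = mi_of_seq t) //.
by apply/ffunP => v; rewrite !ffunE st.
Qed.

End FpsCalculus.

(** * Composition and the Faa di Bruno formula *)

Section Composition.
Variables (K W : finType) (R : comAlgType rat) (G : K -> fps W R).
Hypothesis G0 : forall k, fps_const (G k) = 0.
Implicit Types (f : fps K R) (b : multi_index K) (m : multi_index W).

Definition fps_powm b : fps W R := \prod_k G k ^+ b k.

Lemma fps_powm0 : fps_powm mi_zero = 1.
Proof. by rewrite /fps_powm big1 // => k _; rewrite ffunE expr0. Qed.

Lemma fps_powm_unit b k : fps_powm (mi_add b (mi_unit k)) = fps_powm b * G k.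
Proof.
rewrite /fps_powm (bigD1 k) //= [in RHS](bigD1 k) //= !ffunE eqxx addn1 exprS.
rewrite (eq_bigr (fun l => G l ^+ b l)); first by rewrite -mulrA mulrC.
by move=> l /negPf lk; rewrite !ffunE lk addn0.
Qed.

(** Each factor [G k] has order at least one, so only finitely many [b] contribute to a given
    coefficient of a composition. *)
Lemma fps_powm_eq0 b m : (mi_deg m < mi_deg b)%N -> fps_powm b m = 0.
Proof.
elim/mi_ind: b m => [|b k IHb] m; first by rewrite [X in (_ < X)%N]/mi_deg big1 // => k; rewrite ffunE.
rewrite mi_degD mi_deg_unit addn1 ltnS => mb.
rewrite fps_powm_unit fps_coefM big1_seq // => a /=; rewrite mem_mi_box => am.
have [ab | ab] := ltnP (mi_deg a) (mi_deg b); first by rewrite IHb ?mul0r.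
have md := mi_degD (mi_sub m a) a; rewrite mi_subK // in md.
have /mi_deg_eq0 -> : mi_deg (mi_sub m a) = 0%N by lia.
by rewrite [G k _]G0 mulr0.
Qed.

(** When [b k = 0] the truncated [mi_sub] does not lower [b], but the factor [b k] kills that
    term. *)
Lemma fps_deriv_powm v b :
  fps_deriv v (fps_powm b) =
  \sum_k (fps_deriv v (G k) * fps_powm (mi_sub b (mi_unit k))) *+ b k.
Proof.
elim/mi_ind: b => [|b l IHb].
  by rewrite fps_powm0 fps_deriv1 big1 // => k _; rewrite ffunE.
rewrite fps_powm_unit fps_derivM IHb mulr_suml.
rewrite (bigD1 l) //= [in RHS](bigD1 l) //= addrAC; congr (_ + _); last first.
  apply: eq_bigr => k /negPf kl; rewrite !ffunE kl addn0.
  have [-> | bk] := posnP (b k); first by rewrite !mulr0n mul0r.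
  rewrite mulrnAl; congr (_ *+ _); rewrite -mulrA -fps_powm_unit.
  congr (_ * fps_powm _); apply/ffunP => u; rewrite !ffunE.
  by case: eqP => [->|_]; case: eqP => [kl'|_] //; move: kl; rewrite ?kl' ?eqxx //; lia.
rewrite mi_addK !ffunE eqxx addn1 mulrSr [X in _ + X]mulrC; congr (_ + _).
have [-> | bl] := posnP (b l); first by rewrite !mulr0n mul0r.
rewrite mulrnAl -mulrA -fps_powm_unit mi_subK // mi_unit_le //.
Qed.

(** The box of side [mi_deg m] contains every [b] with [fps_powm b m] nonzero when the [G k] have no
    constant term, so this finite sum is the whole composition. *)
Definition fps_comp f : fps W R := fun m =>
  \sum_(b <- mi_box [ffun=> mi_deg m]) f b * fps_powm b m.

(** A derivative changes the degree, hence the box in [fps_comp]; freedom in the choice of the box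
    is what the chain rule needs. *)
Lemma fps_compE f m (c : multi_index K) : (forall k, mi_deg m <= c k)%N ->
  fps_comp f m = \sum_(b <- mi_box c) f b * fps_powm b m.
Proof.
move=> mc; pose Q b := (mi_deg b <= mi_deg m)%N.
have cut c' : \sum_(b <- mi_box c') f b * fps_powm b m =
    \sum_(b <- [seq b <- mi_box c' | Q b]) f b * fps_powm b m.
  rewrite big_filter (bigID Q) /= [X in _ + X]big1 ?addr0 // => b.
  by rewrite /Q -ltnNge => mb; rewrite fps_powm_eq0 ?mulr0.
rewrite /fps_comp cut [RHS]cut; apply/perm_big/uniq_perm; rewrite ?filter_uniq ?mi_box_uniq //.
move=> b; rewrite !mem_filter !mem_mi_box; apply: andb_id2l => mb.
have bm k : (b k <= mi_deg m)%N := leq_trans (leq_mi_deg b k) mb.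
by apply/mi_leP/mi_leP => _ k; rewrite ?ffunE ?bm // (leq_trans (bm k)).
Qed.

Lemma fps_const_comp f : fps_const (fps_comp f) = fps_const f.
Proof.
rewrite /fps_const (@fps_compE _ _ mi_zero); last first.
  by move=> k; rewrite /mi_deg big1 // => l; rewrite ffunE.
by rewrite mi_box0 big_seq1 fps_powm0 [X in _ * X]fps_const1 mulr1.
Qed.

Lemma fps_deriv_comp v f :
  fps_deriv v (fps_comp f) = \sum_k fps_deriv v (G k) * fps_comp (fps_deriv k f).
Proof.
apply/funext => m; rewrite fps_derivE fps_coef_sum.
(* Side [N + 1] suffices for a coefficient of degree [N + 1]; once a unit is removed in direction
   [k], all sides are still at least [N]. *)
pose N := mi_deg m; pose c : multi_index K := [ffun=> N.+1].
rewrite (@fps_compE _ _ c); last by move=> k; rewrite mi_degD mi_deg_unit ffunE addn1.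
rewrite -sumrMnl.
transitivity (\sum_(b <- mi_box c) \sum_k
    f b * (fps_deriv v (G k) * fps_powm (mi_sub b (mi_unit k))) m *+ b k).
  apply: eq_bigr => b _; rewrite -mulrnAr -fps_derivE fps_deriv_powm fps_coef_sum mulr_sumr.
  by apply: eq_bigr => k _; rewrite fps_coefMn mulrnAr.
rewrite exchange_big; apply: eq_bigr => k _.
pose ck := mi_sub c (mi_unit k).
have cE : c = mi_add ck (mi_unit k) by rewrite mi_subK // mi_unit_le ffunE.
rewrite {1}cE (mi_box_shift _ _
  (fun b => f b * (fps_deriv v (G k) * fps_powm (mi_sub b (mi_unit k))) m)).
transitivity (\sum_(b <- mi_box ck) \sum_(a <- mi_box m)
    fps_deriv v (G k) a * (fps_deriv k f b * fps_powm b (mi_sub m a))).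
  apply: eq_bigr => b _; rewrite mi_addK -mulrnAl -fps_derivE fps_coefM mulr_sumr.
  by apply: eq_bigr => a _; rewrite mulrCA.
rewrite exchange_big fps_coefM; apply: eq_big_seq => a /=; rewrite mem_mi_box => am.
rewrite -mulr_sumr (@fps_compE _ _ ck) // => l.
have := mi_degD (mi_sub m a) a; rewrite mi_subK // !ffunE -/N.
by case: (l == k); lia.
Qed.

End Composition.

(** * Derivatives along a set of labels *)

Section SubsetDerivative.
Variables (T V : finType) (R : comAlgType rat) (w : T -> V).
Implicit Types (f g : fps V R) (S : {set T}).

(** Labels keep repeated directions apart, so that the higher Leibniz rule is a sum over subsets
    without binomial coefficients. *)
Definition dset S f : R := fps_deriv0 f [seq w y | y <- enum S].

Lemma dset0 f : dset set0 f = fps_const f.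
Proof. by rewrite /dset enum_set0. Qed.

Lemma dset_perm S f s : perm_eq (enum S) s -> dset S f = fps_deriv0 f [seq w y | y <- s].
Proof. by move=> Ss; apply/fps_deriv0_perm/perm_map. Qed.

Lemma dsetU1 x S f : x \notin S -> dset (x |: S) f = dset S (fps_deriv (w x) f).
Proof.
move=> xS; rewrite {2}/dset -fps_deriv0_cons (@dset_perm _ _ (x :: enum S)) //.
apply: uniq_perm; rewrite /= ?enum_uniq ?mem_enum ?xS //.
by move=> y; rewrite !inE !mem_enum !inE.
Qed.

Lemma dsetD S f g : dset S (f + g) = dset S f + dset S g.
Proof. by rewrite /dset !fps_deriv0E fps_coefD mulrnDl. Qed.

Lemma dset_zero S : dset S (0 : fps V R) = 0.
Proof. by rewrite /dset fps_deriv0E fps_coef0 mul0rn. Qed.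

Lemma dset_sum S (I : Type) (r : seq I) (P : pred I) (F : I -> fps V R) :
  dset S (\sum_(i <- r | P i) F i) = \sum_(i <- r | P i) dset S (F i).
Proof. exact: (big_morph (dset S) (dsetD S) (dset_zero S)). Qed.

Lemma sum_subset_U1 (M : nmodType) x S (F : {set T} -> M) : x \notin S ->
  \sum_(A : {set T} | A \subset x |: S) F A =
  \sum_(A : {set T} | A \subset S) F (x |: A) + \sum_(A : {set T} | A \subset S) F A.
Proof.
move=> xS; rewrite (bigID (fun A : {set T} => x \in A)) /=; congr (_ + _).
  rewrite (reindex_onto (fun A => x |: A) (fun A => A :\ x)) /=; last first.
    by move=> A /andP[_ xA]; rewrite setD1K.
  apply: eq_bigl => A; rewrite setU11 andbT; apply/andP/idP => [[AS /eqP AE] | AS].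
    by rewrite -AE subDset.
  by rewrite setUS // setU1K ?eqxx //; apply: contra xS; apply/subsetP.
apply: eq_bigl => A; apply/andP/idP => [[AS xA] | AS].
  by rewrite -(setU1K xS) subsetD1 AS.
split; first exact: subset_trans AS (subsetUr _ _).
by apply: contra xS; apply/subsetP.
Qed.

(** Peeling off a label [x], the product rule gives [x] to one factor or to the other, which is the
    splitting of subsets by membership of [x]. *)
Lemma dsetM S f g :
  dset S (f * g) = \sum_(A : {set T} | A \subset S) dset A f * dset (S :\: A) g.
Proof.
have [N] := ubnP #|S|; elim: N S f g => // N IHN S f g SN.
have [-> | [x xS]] := set_0Vmem S.
  rewrite (eq_bigl (fun A => A == set0)) => [|A]; last by rewrite subset0.
  by rewrite big_pred1_eq set0D !dset0 fps_constM.
have xS' : x \notin S :\ x by rewrite !inE eqxx.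
have cS : (#|S :\ x| < N)%N by move: SN; rewrite (cardsD1 x S) xS; lia.
rewrite -(setD1K xS) dsetU1 // fps_derivM dsetD !IHN // sum_subset_U1 //.
congr (_ + _); apply: eq_bigr => A AS.
  have xA : x \notin A by apply: contra xS'; apply/subsetP.
  rewrite -dsetU1 //; congr (_ * dset _ g).
  by apply/setP => y; rewrite !inE; case: (y == x); rewrite ?andbF.
have xA : x \notin A by apply: contra xS'; apply/subsetP.
rewrite -dsetU1 ?inE ?eqxx ?andbF //; congr (_ * dset _ g).
by apply/setP => y; rewrite !inE; case: eqP => // ->; rewrite xA.
Qed.

End SubsetDerivative.

(** * The Faa di Bruno formula as a sum over set partitions of the labels *)

Section FaaDiBruno.
Variables (T K W : finType) (R : comAlgType rat) (G : K -> fps W R).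
Hypothesis G0 : forall k, fps_const (G k) = 0.
Variables (w : T -> W) (k0 : K).
Implicit Types (f : fps K R) (S B : {set T}) (P : {set {set T}}).

(* Maps from the blocks of [P] to [K] are extended by [k0] outside of [P]. *)
Definition supported_on P (ka : {ffun {set T} -> K}) : bool :=
  [forall B, (B \notin P) ==> (ka B == k0)].

(** The blocks of [P] serve in turn as labels: [f] is differentiated once per block, in the
    direction [ka B] that also selects the component of [G] attached to [B]. *)
Definition faa_term P f : R :=
  \sum_(ka : {ffun {set T} -> K} | supported_on P ka)
    dset ka P f * \prod_(B in P) dset w B (G (ka B)).

Lemma faa_term0 f : faa_term set0 f = fps_const f.
Proof.
rewrite /faa_term (big_pred1 [ffun=> k0]) => [|ka].
  by rewrite dset0 big_set0 mulr1.
apply/forallP/eqP => [ka0 | -> B]; last by rewrite ffunE eqxx implybT.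
by apply/ffunP => B; rewrite ffunE; have := ka0 B; rewrite inE => /eqP.
Qed.

Lemma faa_termU1 B P f : B \notin P ->
  faa_term (B |: P) f = \sum_k dset w B (G k) * faa_term P (fps_deriv k f).
Proof.
move=> BP; rewrite /faa_term (partition_big (fun ka : {ffun {set T} -> K} => ka B) predT) //=.
apply: eq_bigr => k _; rewrite mulr_sumr.
(* [upd k] and [upd k0] exchange the functions supported on [P] with those supported on [B |: P]
   that take the value [k] at [B]. *)
pose upd l (ka : {ffun {set T} -> K}) : {ffun {set T} -> K} :=
  [ffun C => if C == B then l else ka C].
rewrite (reindex_onto (upd k) (upd k0)) /=; last first.
  move=> ka /andP[_ /eqP kaB]; apply/ffunP => C; rewrite !ffunE.
  by case: eqP => // ->.
apply: eq_big => ka; last first.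
  move=> _; rewrite dsetU1 // ffunE eqxx big_setU1 //= ffunE eqxx mulrCA.
  have neqB C : C \in P -> (C == B) = false by move=> CP; apply: contraNF BP => /eqP<-.
  congr (_ * (_ * _)).
    congr (fps_deriv0 _ _); apply/eq_in_map => C; rewrite mem_enum => CP.
    by rewrite ffunE neqB.
  by apply: eq_bigr => C CP; rewrite ffunE neqB.
rewrite [upd k ka B]ffunE eqxx eqxx andbT.
apply/andP/forallP => [[/forallP kaS /eqP kaE] C | kaS].
  apply/implyP => CP; have := kaS C; rewrite !inE negb_or CP andbT ffunE.
  by case: (C =P B) => [-> _ | _]; [rewrite -kaE !ffunE eqxx | ].
split; [apply/forallP => C|apply/eqP/ffunP => C; rewrite !ffunE].
  by rewrite !inE negb_or ffunE; case: eqP => //= _; apply: kaS.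
by case: eqP => // ->; have := kaS B; rewrite BP => /eqP.
Qed.

(** Here [x |: A] is the block of [x], and [P] collects the other blocks. *)
Lemma sum_partition_U1 (M : nmodType) x S (F : {set {set T}} -> M) : x \notin S ->
  \sum_(P : {set {set T}} | partition P (x |: S)) F P =
  \sum_(A : {set T} | A \subset S)
    \sum_(P : {set {set T}} | partition P (S :\: A)) F ((x |: A) |: P).
Proof.
move=> xS.
rewrite (partition_big (fun P : {set {set T}} => pblock P x :\ x)
           (fun A : {set T} => A \subset S)) /=; last first.
  move=> P partP; rewrite -(setU1K xS) setSD //.
  apply: (partitionS partP); apply: pblock_mem.
  by rewrite (cover_partition partP) setU11.
apply: eq_bigr => A AS.
have xA : x \notin A by apply: contra xS; apply/subsetP.
have xAS : (x |: S) :\: (x |: A) = S :\: A.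
  by apply/setP => y; rewrite !inE; case: eqP => // ->; rewrite (negPf xS) andbF.
have SU : (x |: A) :|: (S :\: A) = x |: S.
  apply/setP => y; rewrite !inE; case: eqP => //= _; case yA: (y \in A) => //=.
  by rewrite (subsetP AS).
have nP P : partition P (S :\: A) -> x |: A \notin P.
  move=> partP; apply/negP => /(partitionS partP)/subsetP/(_ x).
  by rewrite !inE eqxx (negPf xS) andbF => /(_ isT).
rewrite (reindex_onto (fun P => (x |: A) |: P) (fun P => P :\ (x |: A))) /=; last first.
  move=> P /andP[partP /eqP PA]; apply: setD1K.
  have xc : x \in cover P by rewrite (cover_partition partP) setU11.
  rewrite -PA setD1K ?pblock_mem // mem_pblock //.
apply: eq_bigl => P; apply/andP/idP => [[/andP[partP _] /eqP PE] | partP].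
  by rewrite -PE -xAS; apply: partitionD1 => //; rewrite setU11.
rewrite setU1K ?nP // eqxx; split=> //.
have partxP : partition ((x |: A) |: P) (x |: S).
  rewrite -SU; apply: partitionU1 => //; first by apply/set0Pn; exists x; rewrite setU11.
  rewrite disjoints_subset; apply/subsetP => y; rewrite !inE.
  by case: eqP => [-> _|_ /= ->] //; rewrite (negPf xS) andbF.
rewrite partxP (@def_pblock _ _ (x |: A)) ?setU1K ?eqxx ?setU11 //.
exact: partition_trivIset partxP.
Qed.

(** Peeling off a label [x], the chain rule differentiates some [G k] along [x] and replaces [f] by
    its [k]-th derivative. Leibniz lets a subset [A] of the other labels join [x] in that block, and
    the induction hypothesis partitions the rest. *)
Theorem faa_di_bruno S f :
  dset w S (fps_comp G f) = \sum_(P : {set {set T}} | partition P S) faa_term P f.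
Proof.
have [N] := ubnP #|S|; elim: N S f => // N IHN S f SN.
have [-> | [x xS]] := set_0Vmem S.
  rewrite (eq_bigl (fun P => P == set0)) => [|P]; last by rewrite partition_set0.
  by rewrite big_pred1_eq faa_term0 dset0 fps_const_comp.
have xS' : x \notin S :\ x by rewrite !inE eqxx.
rewrite -(setD1K xS) dsetU1 // fps_deriv_comp // dset_sum sum_partition_U1 //.
under eq_bigr do rewrite dsetM.
rewrite exchange_big; apply: eq_bigr => A AS /=.
have xA : x \notin A by apply: contra xS'; apply/subsetP.
transitivity (\sum_k \sum_(P | partition P (S :\ x :\: A))
    dset w (x |: A) (G k) * faa_term P (fps_deriv k f)).
  apply: eq_bigr => k _; rewrite -dsetU1 // IHN ?mulr_sumr //.
  apply: leq_ltn_trans (subset_leq_card (subsetDl _ _)) _.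
  by move: SN; rewrite (cardsD1 x S) xS; lia.
rewrite exchange_big; apply: eq_bigr => P partP /=; rewrite faa_termU1 //.
apply/negP => /(partitionS partP)/subsetP/(_ x).
by rewrite !inE !eqxx andbF => /(_ isT).
Qed.

End FaaDiBruno.

(** * Gaussian integrals of monomials *)

(** The letters of colour [x] fill the places where [s] has [x] injectively, and distinct colours do
    not interact: one falling factorial per colour. [A] is general because the induction removes the
    head letter from the alphabet. *)
Lemma card_colored_uniq_tuples (L C : finType) (c : L -> C) (n : nat) (s : seq C) (A : pred L) :
  size s = n ->
  #|[set t : n.-tuple L | [&& all A t, uniq t & map c t == s]]| =
  (\prod_x #|[pred l | A l && (c l == x)]| ^_ (count_mem x s))%N.
Proof.
elim: s n A => [|x s IHs] n A ns.
  case: n ns => // _; rewrite big1 // (@eq_card1 _ [tuple]) // => t.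
  by rewrite [t]tuple0 !inE.
case: n ns => // n [ns].
pose Ax := [pred l | A l && (c l == x)].
rewrite -sum1dep_card (partition_big (@thead _ _) Ax) /= => [|t]; last first.
  case/tupleP: t => l t /=; rewrite theadE eqseq_cons.
  by case/and3P=> /andP[-> _] _ /andP[-> _].
rewrite (bigD1 x) //= eqxx add1n ffactnS -mulnA.
transitivity (\sum_(l | Ax l) (#|Ax|.-1 ^_ (count_mem x s) *
   \prod_(y | y != x) #|[pred l | A l && (c l == y)]| ^_ (count_mem y s)))%N; last first.
  rewrite sum_nat_const; congr (_ * (_ * _))%N.
  by apply: eq_bigr => y yx; rewrite eq_sym (negPf yx).
apply: eq_bigr => l /andP[Al cl].
pose Al' := [predD1 A & l].
transitivity #|[set t : n.-tuple L | [&& all Al' t, uniq t & map c t == s]]|; last first.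
  rewrite IHs // (bigD1 x) //=; congr (_ ^_ _ * _)%N.
    rewrite (cardD1 l Ax) [l \in Ax]inE /= Al cl /=; apply: eq_card => l'.
    by rewrite !inE andbA.
  apply: eq_bigr => y yx; congr (_ ^_ _)%N; apply: eq_card => l'; rewrite !inE.
  by case: eqP => //= ->; rewrite (eqP cl) eq_sym (negPf yx) andbF.
rewrite -sum1dep_card (reindex (fun t : n.-tuple L => [tuple of l :: t])) /=; last first.
  pose ttail (t : n.+1.-tuple L) := [tuple of behead t].
  exists ttail => [t _ | t /andP[_ /eqP <-]]; first exact: val_inj.
  by rewrite -tuple_eta.
apply: eq_bigl=> t; rewrite theadE eqxx andbT /= Al eqseq_cons cl /=.
rewrite all_predI all_predC has_pred1 -!andbA.
by case: (all A t); case: (l \in t).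
Qed.

(** The product of Kronecker symbols is the indicator of value-preserving bijections. These exist
    only between rearrangements of one sequence, and then permute freely the positions carrying each
    value. *)
Lemma sum_bij_kronecker (C : finType) (R : comAlgType rat) (s s' : seq C) :
  \sum_(f : {ffun 'I_(size s) -> 'I_(size s')} | bijectiveb f)
     \prod_k (tnth (in_tuple s') (f k) == tnth (in_tuple s) k)%:R =
  (if perm_eq s s' then \prod_x (count_mem x s)`! else 0)%N%:R :> R.
Proof.
pose ok (f : {ffun 'I_(size s) -> 'I_(size s')}) :=
  [forall k, tnth (in_tuple s') (f k) == tnth (in_tuple s) k].
have enumE (u : seq C) : [seq tnth (in_tuple u) k | k <- enum 'I_(size u)] = u.
  by have := congr1 val (tuple_map_ord (in_tuple u)).
have okE f : ok f = ([seq tnth (in_tuple s') l | l <- codom f] == s).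
  transitivity ([seq tnth (in_tuple s') l | l <- codom f] ==
      [seq tnth (in_tuple s) k | k <- enum 'I_(size s)]); last by rewrite enumE.
  rewrite codomE -map_comp.
  apply/forallP/eqP => [fk | /eq_in_map fk k].
    by apply: eq_map => k; apply/eqP/fk.
  by apply/eqP/fk; rewrite mem_enum.
transitivity (#|[set f | bijectiveb f && ok f]|%:R : R).
  rewrite -sum1dep_card natr_sum [RHS]big_mkcondr; apply: eq_bigr => f _.
  case: ifP => [/forallP fk | /forallPn[k /negPf fk]].
    by rewrite big1 // => k _; rewrite fk.
  by rewrite (bigD1 k) //= fk mul0r.
congr (_%:R); case: ifPn => [ss' | nss']; last first.
  apply: eq_card0 => f; rewrite !inE; apply: contraNF nss' => /andP[/andP[/injectiveP f_inj /forallP f_sur]].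
  rewrite okE => /eqP <-; rewrite -[s' in perm_eq _ s']enumE perm_map //.
  apply: uniq_perm; [exact/injectiveP | exact: enum_uniq | move=> l].
  by rewrite mem_enum inE f_sur.
have sz := perm_size ss'.
(* With equal sizes injectivity suffices, which turns bijections into duplicate-free tuples of
   positions of [s'], coloured by their values. *)
transitivity #|[set f : {ffun 'I_(size s) -> 'I_(size s')} | injectiveb f && ok f]|.
  apply: eq_card => f; rewrite !inE /bijectiveb; congr (_ && _).
  apply: andb_idr => /injectiveP f_inj; apply/forallP => y.
  by apply: inj_card_onto => //; rewrite !card_ord sz.
have bijFF: {on (_ : pred _), bijective (@Finfun 'I_(size s) 'I_(size s'))}.
  by exists fgraph => x _; [apply: FinfunK | apply: fgraphK].
rewrite -(on_card_preimset (bijFF _)).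
transitivity #|[set t : #|'I_(size s)|.-tuple 'I_(size s') |
    [&& all predT t, uniq t & [seq tnth (in_tuple s') l | l <- t] == s]]|.
  apply: eq_card => t; rewrite !inE okE all_predT /=.
  by rewrite /injectiveb /dinjectiveb -[t in RHS]FinfunK -codom_ffun.
rewrite card_colored_uniq_tuples ?card_ord //; apply: eq_bigr => x _.
rewrite (_ : #|_| = count_mem x s) ?ffactnn //.
move/seq.permP: ss' => ->; rewrite -[s' in RHS]enumE count_map -size_filter cardE.
by rewrite /enum_mem filter_predT.
Qed.

Section MonomialIntegral.
Variables (n : nat) (R : comAlgType rat) (m : multi_index (gvar n)).

Lemma count_tau_seq r k : count_mem k (tau_seq m r) = m (r, k).
Proof.
rewrite /tau_seq count_flatten -map_comp sumnE big_map big_enum /= (bigD1 k) //=.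
rewrite count_nseq /= eqxx mul1n big1 ?addn0 // => l /negPf lk.
by rewrite count_nseq /= lk.
Qed.

Definition matched r r' : bool := [forall k, m (r, k) == m (r', k)].

Lemma perm_tau_seq r r' : perm_eq (tau_seq m r) (tau_seq m r') = matched r r'.
Proof.
rewrite /perm_eq; apply/idP/forallP => [/seq.permP E k | E].
  by rewrite -!count_tau_seq E.
by apply/allP => k _ /=; rewrite !count_tau_seq.
Qed.

Lemma mon_integralE :
  mon_integral R m =
  if [&& matched v_sbar v_s, matched v_tbar v_t & matched v_ubar v_u]
  then (\prod_k (m (v_sbar, k))`! * \prod_k (m (v_tbar, k))`! * \prod_k (m (v_ubar, k))`!)%N%:R
  else 0.
Proof.
pose kr r r' := (\sum_(f : {ffun 'I_(size (tau_seq m r)) -> 'I_(size (tau_seq m r'))} | bijectiveb f)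
     \prod_k (tnth (in_tuple (tau_seq m r')) (f k) == tnth (in_tuple (tau_seq m r)) k)%:R) : R.
have krE r r' : kr r r' = (if matched r r' then \prod_k (m (r, k))`! else 0)%N%:R.
  rewrite /kr sum_bij_kronecker perm_tau_seq; case: ifP => // _.
  by congr (_%:R); apply: eq_bigr => k _; rewrite count_tau_seq.
transitivity (kr v_sbar v_s * kr v_tbar v_t * kr v_ubar v_u).
  rewrite /mon_integral /kr !mulr_suml; apply: eq_bigr => f _.
  rewrite [A in A * _]mulr_sumr mulr_suml; apply: eq_bigr => g _.
  by rewrite mulr_sumr.
rewrite !krE; do 3!case: (matched _ _) => /=; rewrite -?natrM ?muln0 ?mul0n //.
Qed.

End MonomialIntegral.

(** * The integral *)

Section Substitution.
Variables (n : nat) (R : comAlgType rat).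
Implicit Types (f g : fps 'I_n R) (m : multi_index (gvar n)) (r : 'I_6) (k : 'I_n).

Lemma fps_const_in r f : fps_const (fps_in r f) = fps_const f.
Proof.
rewrite /fps_const /fps_in ifT; first by congr f; apply/ffunP => k; rewrite !ffunE.
by apply/forallP => v; rewrite ffunE eqxx implybT.
Qed.

Lemma fps_inD r f g : fps_in r (f + g) = fps_in r f + fps_in r g :> fps (gvar n) R.
Proof. by apply/funext => m; rewrite fps_coefD /fps_in; case: ifP => // _; rewrite add0r. Qed.

Lemma fps_deriv_in r k f : fps_deriv (r, k) (fps_in r f) = fps_in r (fps_deriv k f).
Proof.
apply/funext => m; rewrite fps_derivE /fps_in.
have -> : [forall v : gvar n, (v.1 != r) ==> (mi_add m (mi_unit (r, k)) v == 0%N)] =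
    [forall v : gvar n, (v.1 != r) ==> (m v == 0%N)].
  apply: eq_forallb => v; case: eqP => //= vr; rewrite !ffunE.
  by case: (v =P _) => [E|_]; rewrite ?addn0 //; case: vr; rewrite E.
case: ifP => _; last by rewrite mul0rn.
rewrite fps_derivE ffunE; congr (f _ *+ _).
by apply/ffunP => l; rewrite !ffunE xpair_eqE eqxx.
Qed.

Lemma fps_deriv_in_neq r r' k f : r' != r -> fps_deriv (r', k) (fps_in r f) = 0.
Proof.
move=> rr'; apply/funext => m; rewrite fps_derivE /fps_in ifF ?mul0rn //.
by apply/forallP => /(_ (r', k)); rewrite rr' !ffunE eqxx addn1.
Qed.

(** Substitution commutes with the derivatives in the [r]-th vector and is killed by all others, so
    the Leibniz rule avoids comparing Cauchy products in different sets of variables. *)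
Lemma fps_inM r f g : fps_in r (f * g) = fps_in r f * fps_in r g :> fps (gvar n) R.
Proof.
apply/funext => m; elim/mi_ind: m f g => [|m [r' k] IHm] f g.
  have : fps_const (fps_in r (f * g)) = fps_const (fps_in r f * fps_in r g : fps (gvar n) R).
    by rewrite fps_constM !fps_const_in fps_constM.
  by [].
apply: fps_eq_step; rewrite fps_derivM.
have [-> | rr'] := eqVneq r' r.
  by rewrite !fps_deriv_in fps_derivM fps_inD !fps_coefD !IHm.
by rewrite !fps_deriv_in_neq // mul0r mulr0 addr0.
Qed.

Lemma fps_in1 r : fps_in r 1 = 1 :> fps (gvar n) R.
Proof.
apply/funext => m; case: (mi_ind (Q := fun m => m = mi_zero \/ exists v, 0 < m v)%N _ _ m).
- by left.
- by move=> m' v _; right; exists v; rewrite !ffunE eqxx addn1.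
- move=> ->; transitivity (1 : R); last exact/esym/fps_const1.
  by rewrite -[RHS](fps_const1 'I_n R) -(fps_const_in r).
move=> [v]; rewrite -mi_unit_le => /mi_subK <-; apply: fps_eq_step.
case: v => r' k; rewrite fps_deriv1; have [-> | rr'] := eqVneq r' r.
  rewrite fps_deriv_in fps_deriv1 /fps_in fps_coef0.
  by case: ifP.
by rewrite fps_deriv_in_neq.
Qed.

Lemma fps_in_powm (H : 'I_n -> fps 'I_n R) r b :
  fps_in r (fps_powm H b) = fps_powm (fun k => fps_in r (H k) : fps (gvar n) R) b.
Proof.
elim/mi_ind: b => [|b k IHb]; first by rewrite !fps_powm0 fps_in1.
by rewrite !fps_powm_unit fps_inM IHb.
Qed.

(** The vectors come in the order [sbar], [s], [tbar], [t], [ubar], [u]; those past the end of [l]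
    are zero. *)
Definition mi_join (l : seq (multi_index 'I_n)) : multi_index (gvar n) :=
  [ffun v : gvar n => nth mi_zero l v.1 v.2].

(** The two vectors are disjoint, so a single splitting of [m] contributes: the one that gives all
    [r] entries to the first factor. *)
Lemma fps_coef_inM r r' f g (a b : multi_index 'I_n) m : r != r' ->
  (forall v, m v = if v.1 == r then a v.2 else if v.1 == r' then b v.2 else 0)%N ->
  (fps_in r f * fps_in r' g : fps (gvar n) R) m = f a * g b.
Proof.
move=> rr' mE.
pose z : multi_index (gvar n) := [ffun v => if v.1 == r then a v.2 else 0%N].
have zm : mi_le z m by apply/mi_leP => v; rewrite mE !ffunE; case: eqP.
rewrite fps_coefM (bigD1_seq z) ?mi_box_uniq ?mem_mi_box //= big1_seq ?addr0.
  congr (_ * _); rewrite /fps_in ifT.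
  - by congr f; apply/ffunP => k; rewrite !ffunE eqxx.
  - by apply/forallP => v; rewrite !ffunE; case: (v.1 == r).
  - congr g; apply/ffunP => k; rewrite !ffunE mE /= eqxx.
    by rewrite eq_sym (negPf rr') subn0.
  apply/forallP => v; rewrite !ffunE mE; case: (v.1 =P r') => //= vr'.
  by case: (v.1 == r); rewrite ?subnn.
move=> y /andP[/eqP yz]; rewrite mem_mi_box => /mi_leP ym.
rewrite /fps_in; case: ifP => [/forallP yr|]; rewrite ?mul0r //.
case: ifP => [/forallP yr'|]; rewrite ?mulr0 //.
case: yz; apply/ffunP => v; rewrite !ffunE; case: eqP => vr.
  have := yr' v; rewrite vr rr' !ffunE mE vr eqxx /= subn_eq0 => ay.
  by apply/eqP; rewrite eqn_leq ay andbT; have := ym v; rewrite mE vr eqxx.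
by have := yr v; case: eqP => //= _ /eqP.
Qed.

Lemma fps_pairingE r r' (H : 'I_n -> fps 'I_n R) :
  fps_pairing r r' H = \sum_k fps_var R (r, k) * fps_in r' (H k) :> fps (gvar n) R.
Proof. by []. Qed.

Lemma fps_const_pairing r r' (H : 'I_n -> fps 'I_n R) : fps_const (fps_pairing r r' H) = 0.
Proof.
rewrite fps_pairingE /fps_const fps_coef_sum big1 // => k _.
by rewrite fps_coef_varM ffunE.
Qed.

Lemma fps_deriv_pairing r r' (H : 'I_n -> fps 'I_n R) k : r != r' ->
  fps_deriv (r, k) (fps_pairing r r' H) = fps_in r' (H k).
Proof.
move=> rr'; rewrite fps_pairingE fps_deriv_sum (bigD1 k) //= big1 ?addr0.
  by rewrite fps_derivM fps_deriv_var eqxx mul1r fps_deriv_in_neq // mulr0 addr0.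
move=> l /negPf lk; rewrite fps_derivM fps_deriv_var fps_deriv_in_neq //.
by rewrite xpair_eqE eqxx /= eq_sym lk mul0r mulr0 addr0.
Qed.

Lemma fps_deriv_pairing_neq r0 r r' (H : 'I_n -> fps 'I_n R) k : r0 != r -> r0 != r' ->
  fps_deriv (r0, k) (fps_pairing r r' H) = 0.
Proof.
move=> r0r r0r'; rewrite fps_pairingE fps_deriv_sum big1 // => l _.
rewrite fps_derivM fps_deriv_var fps_deriv_in_neq //.
by rewrite xpair_eqE (negPf r0r) mul0r mulr0 addr0.
Qed.

End Substitution.

(** * Coefficients of the exponential of the action, and the integral *)

Section ActionIntegral.
Variables (n : nat) (R : comAlgType rat) (F G : 'I_n -> fps 'I_n R).
Implicit Types (m : multi_index (gvar n)).

Definition action : fps (gvar n) R :=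
  fps_add (fps_pairing v_sbar v_t F) (fps_pairing v_tbar v_u G).

Lemma actionE : action = fps_pairing v_sbar v_t F + fps_pairing v_tbar v_u G.
Proof. by []. Qed.

Lemma fps_const_action : fps_const action = 0.
Proof. by rewrite actionE fps_constD !fps_const_pairing addr0. Qed.

Lemma fps_deriv_action_sbar k : fps_deriv (v_sbar, k) action = fps_in v_t (F k).
Proof. by rewrite actionE fps_derivD fps_deriv_pairing // fps_deriv_pairing_neq // addr0. Qed.

Lemma fps_deriv_action_tbar k : fps_deriv (v_tbar, k) action = fps_in v_u (G k).
Proof. by rewrite actionE fps_derivD fps_deriv_pairing // fps_deriv_pairing_neq // add0r. Qed.

Lemma fps_deriv_action_0 r k : r \in [:: v_s; v_ubar] -> fps_deriv (r, k) action = 0.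
Proof.
by rewrite !inE actionE fps_derivD => /orP[]/eqP->; rewrite !fps_deriv_pairing_neq // addr0.
Qed.

Lemma fps_deriv0_coef (g : fps (gvar n) R) v m : fps_deriv v g = 0 -> (0 < m v)%N -> g m = 0.
Proof.
move=> g0; rewrite -mi_unit_le => /mi_subK <-.
by apply: (@fps_eq_step _ _ _ _ 0); rewrite g0 fps_deriv_zero.
Qed.

(** The action is free of [s] and [ubar], hence so is its exponential; in the integrand those
    exponents come from the prefactor alone. *)
Lemma exp_action_coef0 r k m :
  r \in [:: v_s; v_ubar] -> (0 < m (r, k))%N -> fps_exp action m = 0.
Proof.
move=> rs; apply: fps_deriv0_coef.
by rewrite fps_deriv_exp ?fps_const_action // fps_deriv_action_0 // mul0r.
Qed.

Definition unbarred m := forall k, (m (v_sbar, k) = 0 /\ m (v_tbar, k) = 0)%N.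

Lemma action_coef_unbarred m : unbarred m -> action m = 0.
Proof.
move=> m0; rewrite actionE !fps_pairingE fps_coefD !fps_coef_sum !big1 ?addr0 // => k _;
by rewrite fps_coef_varM ?(m0 k).1 ?(m0 k).2.
Qed.

(** Every monomial of the action contains an [sbar] or a [tbar], so only the power 0 of the action
    contributes. *)
Lemma exp_action_coef_unbarred m : unbarred m -> fps_exp action m = (1 : fps (gvar n) R) m.
Proof.
move=> m0; rewrite (@fps_expE _ _ _ (mi_deg m).+1) ?fps_const_action //.
rewrite big_ord_recl expr0 fact0 invr1 scale1r big1 ?addr0 // => k _.
rewrite exprS fps_coefM big1_seq ?scaler0 // => a /=; rewrite mem_mi_box => /mi_leP am.
rewrite action_coef_unbarred ?mul0r // => l.
have [m1 m2] := m0 l; have := am (v_sbar, l); have := am (v_tbar, l).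
by rewrite m1 m2 !leqn0 => /eqP-> /eqP->.
Qed.

Lemma exp_actionM_coef_unbarred (h : fps (gvar n) R) m :
  unbarred m -> (h * fps_exp action) m = h m.
Proof.
move=> m0; rewrite -[RHS](congr1 (fun g : fps (gvar n) R => g m) (mulr1 h)) !fps_coefM.
apply: eq_big_seq => a; rewrite mem_mi_box => /mi_leP am.
rewrite exp_action_coef_unbarred // => k.
by rewrite !ffunE; have [-> ->] := m0 k.
Qed.

Definition mi_tbar (b : multi_index 'I_n) : multi_index (gvar n) :=
  mi_join [:: mi_zero; mi_zero; b].

(** Each derivative along [tbar_k] brings down a factor [G k] in [u]; extracting the exponent [b] of
    [tbar] this way costs [b!]. The series [h] absorbs the factors already brought down. *)
Lemma exp_action_coef_tbar b (h : fps (gvar n) R) m :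
  (forall k, fps_deriv (v_tbar, k) h = 0) -> unbarred m ->
  (h * fps_exp action) (mi_add m (mi_tbar b)) *+ mi_fact b =
  (h * fps_powm (fun k => fps_in v_u (G k) : fps (gvar n) R) b * fps_exp action) m.
Proof.
elim/mi_ind: b h => [|b k IHb] h h0 m0.
  rewrite fps_powm0 mulr1 /mi_fact big1 => [|k _]; last by rewrite ffunE.
  rewrite (_ : mi_add _ _ = m) //; apply/ffunP => -[r k]; rewrite !ffunE /=.
  by case: (nat_of_ord r) => [|[|[|[|?]]]]; rewrite /= ?nth_nil ffunE addn0.
have -> : mi_tbar (mi_add b (mi_unit k)) = mi_add (mi_tbar b) (mi_unit (v_tbar, k)).
  apply/ffunP => -[r l]; rewrite !ffunE /= xpair_eqE -val_eqE /=.
  by case: (nat_of_ord r) => [|[|[|?]]]; rewrite /= ?nth_nil ?ffunE.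
rewrite mi_addA mi_fact_unit mulnC mulrnA.
have mb : (mi_add m (mi_tbar b) (v_tbar, k)).+1 = (b k).+1.
  by rewrite !ffunE /= (m0 k).2.
rewrite -mb -fps_derivE fps_derivM h0 mul0r add0r.
rewrite fps_deriv_exp ?fps_const_action // fps_deriv_action_tbar mulrA.
rewrite IHb // => [|l]; last by rewrite fps_derivM h0 fps_deriv_in_neq // mul0r mulr0 addr0.
by rewrite fps_powm_unit (mulrC (fps_powm _ b)) (mulrA h).
Qed.

(** The identity keeps the factor [b!] instead of dividing by it, since the Gaussian integral over
    [tbar] and [t] supplies exactly this factor. *)
Lemma exp_action_coef i (b c : multi_index 'I_n) :
  fps_exp action (mi_join [:: mi_unit i; mi_zero; b; b; mi_zero; c]) *+ mi_fact b =
  F i b * fps_powm G b c.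
Proof.
pose m := mi_join [:: mi_zero; mi_zero; mi_zero; b; mi_zero; c].
have m0 : unbarred m by move=> k; rewrite !ffunE.
have -> : mi_join [:: mi_unit i; mi_zero; b; b; mi_zero; c] =
    mi_add (mi_add m (mi_tbar b)) (mi_unit (v_sbar, i)).
  apply/ffunP => -[r k]; rewrite !ffunE /= xpair_eqE -val_eqE /=.
  by case: (nat_of_ord r) => [|[|[|[|[|[|?]]]]]]; rewrite /= ?nth_nil ?ffunE ?addn0.
have -> : fps_exp action (mi_add (mi_add m (mi_tbar b)) (mi_unit (v_sbar, i))) =
    (fps_in v_t (F i) * fps_exp action) (mi_add m (mi_tbar b)).
  rewrite -fps_deriv_action_sbar -fps_deriv_exp ?fps_const_action // fps_derivE.
  by rewrite !ffunE.
rewrite exp_action_coef_tbar // => [|k]; last by rewrite fps_deriv_in_neq.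
rewrite exp_actionM_coef_unbarred // -fps_in_powm (@fps_coef_inM _ _ _ _ _ _ b c) //.
move=> [r k]; rewrite !ffunE /= -!val_eqE /=.
by case: (nat_of_ord r) => [|[|[|[|[|[|?]]]]]]; rewrite /= ?nth_nil ?ffunE.
Qed.

Hypothesis G0 : forall k, fps_const (G k) = 0.
Variables (d : nat) (i : 'I_n) (j : 'I_d -> 'I_n).

Definition integrand : fps (gvar n) R :=
  fps_mul (fps_var R (v_s, i))
    (fps_mul
      (\big[@fps_mul _ R / @fps_one _ R]_(nu < d) fps_var R (v_ubar, j nu))
      (fps_exp action)).

(** [ins] is the exponent of the prefactor. The multi-indices [tot b] are those that can survive
    integration, with [b] the common exponent of [tbar] and [t]. *)
Let c := mi_of_seq [seq j nu | nu <- enum 'I_d].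
Let ins := mi_join [:: mi_zero; mi_unit i; mi_zero; mi_zero; c; mi_zero].
Let tot b := mi_join [:: mi_unit i; mi_unit i; b; b; c; c].

Lemma integrand_coef m :
  integrand m = if mi_le ins m then fps_exp action (mi_sub m ins) else 0.
Proof.
pose s : seq (gvar n) := (v_s, i) :: [seq (v_ubar, j nu) | nu <- enum 'I_d].
have -> : integrand = (\prod_(v <- s) fps_var R v) * fps_exp action.
  rewrite big_cons big_map big_enum -mulrA.
  by [].
have -> : ins = mi_of_seq s.
  apply/ffunP => -[r k]; rewrite !ffunE /= count_map xpair_eqE -!val_eqE /=.
  rewrite (@eq_count _ _ (fun nu => (r == v_ubar) && (j nu == k))); last first.
    by move=> nu; rewrite /= xpair_eqE (eq_sym r).
  rewrite -val_eqE /=; case: (nat_of_ord r) => [|[|[|[|[|[|?]]]]]] /=;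
    rewrite ?nth_nil ?ffunE ?count_pred0 ?addn0 ?count_map ?add0n //.
  by rewrite eq_sym.
exact: fps_coef_prod_varM.
Qed.

Lemma tot_inj : injective tot.
Proof.
move=> a b /ffunP ab; apply/ffunP => k; have := ab (v_t, k).
by rewrite !ffunE.
Qed.

Lemma integrand_tot b :
  integrand (tot b) * mon_integral R (tot b) = (F i b * fps_powm G b c) *+ mi_fact c.
Proof.
rewrite integrand_coef mon_integralE ifT; last first.
  apply/mi_leP => -[r k]; rewrite !ffunE /=.
  by case: (nat_of_ord r) => [|[|[|[|[|[|?]]]]]]; rewrite /= ?nth_nil ?ffunE.
rewrite ifT; last by rewrite /matched; apply/and3P; split; apply/forallP => k; rewrite !ffunE.
rewrite -exp_action_coef -mulrnA mulr_natr.
congr (fps_exp action _ *+ _).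
  apply/ffunP => -[r k]; rewrite !ffunE /=.
  by case: (nat_of_ord r) => [|[|[|[|[|[|?]]]]]]; rewrite /= ?nth_nil ?ffunE ?subnn ?subn0.
congr (_ * _)%N; last by apply: eq_bigr => k _; rewrite !ffunE.
rewrite [X in (X * _)%N]big1 ?mul1n; last by move=> k _; rewrite !ffunE; case: (_ == _).
by apply: eq_bigr => k _; rewrite !ffunE.
Qed.

(** The prefactor fixes the exponents of [s] and [ubar]; matching then fixes those of [sbar] and [u]
    and equates those of [tbar] and [t]. The remaining [b] is bounded because [fps_powm G b]
    vanishes below the degree of [b]. *)
Lemma integrand_supp m : integrand m * mon_integral R m != 0 ->
  m \in [seq tot b | b <- mi_box [ffun=> mi_deg c]].
Proof.
move=> mN0.
suff [b mb] : exists b, m = tot b.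
  rewrite mb; apply: map_f; rewrite mem_mi_box; apply/mi_leP => k; rewrite ffunE.
  apply: leq_trans (leq_mi_deg b k) _; rewrite leqNgt; apply: contraNN mN0 => cb.
  by rewrite mb integrand_tot fps_powm_eq0 ?mulr0 ?mul0rn.
move: mN0; rewrite integrand_coef mon_integralE.
case: ifP => [/mi_leP insm|]; last by rewrite mul0r eqxx.
case: ifP => [/and3P[/forallP m01 /forallP m23 /forallP m45]|]; last by rewrite mulr0 eqxx.
move=> mN0.
have ins0 r k : r \in [:: v_s; v_ubar] -> m (r, k) = ins (r, k).
  move=> rs; apply/eqP; rewrite eqn_leq insm andbT -subn_eq0 -leqn0 leqNgt.
  apply: contraNN mN0 => lt0; rewrite (@exp_action_coef0 r k) ?mul0r //.
  by rewrite ffunE.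
exists [ffun k => m (v_t, k)].
have ms k : m (v_s, k) = mi_unit i k by rewrite ins0 // !ffunE.
have mu k : m (v_ubar, k) = c k by rewrite ins0 // !ffunE.
apply/ffunP => -[r k]; rewrite !ffunE /=.
have rE (r' : 'I_6) : nat_of_ord r = r' -> r = r' by move/val_inj.
case rN: (nat_of_ord r) (ltn_ord r) => [|[|[|[|[|[|?]]]]]] //= _.
- by rewrite (rE v_sbar rN) (eqP (m01 k)) ms.
- by rewrite (rE v_s rN) ms.
- by rewrite (rE v_tbar rN) (eqP (m23 k)) ffunE.
- by rewrite (rE v_t rN) ffunE.
- by rewrite (rE v_ubar rN) mu.
by rewrite (rE v_u rN) -(eqP (m45 k)) mu.
Qed.

Lemma integrand_integrable : gauss_integrable integrand.
Proof.
apply: sub_finite_set (finite_seq [seq tot b | b <- mi_box [ffun=> mi_deg c]]).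
by move=> m /=; apply: integrand_supp.
Qed.

Lemma gauss_integral_comp :
  gauss_integral integrand = dset j [set: 'I_d] (fps_comp G (F i)).
Proof.
rewrite /gauss_integral (fsbigE [seq tot b | b <- mi_box [ffun=> mi_deg c]]).
- under eq_bigl do rewrite classical_sets.in_setT.
  rewrite big_map; under eq_bigr do rewrite integrand_tot.
  (* The box is the one in [fps_comp] at [c], so the sum is the composed coefficient by definition,
     and [mi_fact c] turns it into a derivative at 0. *)
  by rewrite sumrMnl /dset fps_deriv0E enum_setT -enumT.
- by rewrite map_inj_uniq ?mi_box_uniq //; apply: tot_inj.
- by [].
by move=> m _; apply: contraNeq; apply: integrand_supp.
Qed.

End ActionIntegral.

(** * Structure of Feynman diagrams *)

Section ValidDiagram.
Local Open Scope nat_scope.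
Variables (d : nat) (E : finType) (D : fey d E).
Hypothesis vD : is_fey D.
Implicit Types (x y : E) (B : {set E}) (nu : 'I_d).

Let vP : is_prefey D. Proof. by case: vD. Qed.

Definition parts : seq {set E} :=
  [:: E_sbar D; E_s D; E_tbar D; E_t D; E_ubar D; E_u D].

(** Numbering the six parts turns disjointness and covering into case analysis on a number below
    6. *)
Definition part_of x : nat := find (fun A : {set E} => x \in A) parts.

Lemma part_of_lt x : (part_of x < 6)%N.
Proof.
rewrite -[6]/(size parts) -has_find.
have : x \in [set: E] by rewrite inE.
by rewrite -(prefey_cover6 vP) /= orbF !inE -!orbA.
Qed.

Lemma mem_part_of x : x \in nth set0 parts (part_of x).
Proof.
apply: (@nth_find _ set0 (fun A : {set E} => x \in A) parts).
by rewrite has_find; apply: part_of_lt.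
Qed.

Lemma mem_parts r x : (r < 6)%N -> (x \in nth set0 parts r) = (part_of x == r).
Proof.
move=> r6; apply/idP/eqP => [xr | <-]; last exact: mem_part_of.
have [| xlt | //] := ltngtP (part_of x) r; last first.
  by have := before_find set0 xlt; rewrite xr.
move=> xlt; have xp := mem_part_of x.
have /(pairwiseP set0)/(_ _ _ (part_of_lt x) r6 xlt) := prefey_disj6 vP.
by rewrite disjoint_subset => /subsetP/(_ x xp); rewrite inE xr.
Qed.

Lemma in_sbar x : (x \in E_sbar D) = (part_of x == 0%N). Proof. exact: (@mem_parts 0). Qed.
Lemma in_s x : (x \in E_s D) = (part_of x == 1%N). Proof. exact: (@mem_parts 1). Qed.
Lemma in_tbar x : (x \in E_tbar D) = (part_of x == 2). Proof. exact: (@mem_parts 2). Qed.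
Lemma in_t x : (x \in E_t D) = (part_of x == 3). Proof. exact: (@mem_parts 3). Qed.
Lemma in_ubar x : (x \in E_ubar D) = (part_of x == 4). Proof. exact: (@mem_parts 4). Qed.
Lemma in_u x : (x \in E_u D) = (part_of x == 5). Proof. exact: (@mem_parts 5). Qed.
Definition in_parts := (in_sbar, in_s, in_tbar, in_t, in_ubar, in_u).

Lemma pi_F_part B x : B \in pi_F D -> x \in B -> part_of x \in [:: 0; 3]%N.
Proof.
by move=> /(prefey_F vP)[-> _ _]; rewrite !inE -!andb_orr !in_parts => /andP[].
Qed.

Lemma pi_G_part B x : B \in pi_G D -> x \in B -> part_of x \in [:: 2; 5]%N.
Proof.
by move=> /(prefey_G vP)[-> _ _]; rewrite !inE -!andb_orr !in_parts => /andP[].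
Qed.

Definition block x : {set E} := pblock (pi_F D :|: pi_G D) x.

Lemma mem_block x : x \in E_int D -> x \in block x.
Proof. by move=> xi; rewrite mem_pblock (cover_partition (prefey_part vP)). Qed.

Lemma block_def B x : B \in pi_F D :|: pi_G D -> x \in B -> block x = B.
Proof. by move=> BP xB; apply: def_pblock => //; apply: partition_trivIset (prefey_part vP). Qed.

Lemma block_pi x : x \in E_int D -> block x \in pi_F D :|: pi_G D.
Proof. by move=> xi; apply: pblock_mem; rewrite (cover_partition (prefey_part vP)). Qed.

Lemma in_int x : (x \in E_int D) = (x \notin E_ext D).
Proof.
have : x \in [set: E] by rewrite inE.
have := prefey_disj2 vP; rewrite disjoint_subset => /subsetP/(_ x).
rewrite -(prefey_cover2 vP) !inE => dis; case xi: (x \in E_int D) => /=.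
  by rewrite dis.
by move=> ->.
Qed.

(** Elements of blocks lie in [E_sbar], [E_t], [E_tbar] or [E_u], so no element of [E_s] or [E_ubar]
    is internal. All of them are therefore labelled by [rho_s] and [rho_ubar]. *)
Lemma in_ext x : (x \in E_ext D) = (part_of x \in [:: 1; 4]%N).
Proof.
have := part_of_lt x => lt6; apply/idP/idP => [xe | xp].
  have : x \notin set0 by rewrite inE.
  rewrite -(prefey_ext vP) !inE xe andbT !in_parts.
  by case: (part_of x) lt6 => [|[|[|[|[|[|]]]]]].
apply: contraLR isT; rewrite -in_int => xi.
have := block_pi xi; rewrite inE => /orP[] bP.
  by have := pi_F_part bP (mem_block xi); move: xp; rewrite !inE => /orP[]/eqP->.
by have := pi_G_part bP (mem_block xi); move: xp; rewrite !inE => /orP[]/eqP->.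
Qed.

Lemma block_F x : part_of x \in [:: 0; 3]%N -> block x \in pi_F D /\ x \in block x.
Proof.
move=> xp; have xi : x \in E_int D.
  by rewrite in_int in_ext; move: xp; rewrite !inE => /orP[]/eqP->.
split; last exact: mem_block.
have := block_pi xi; rewrite inE => /orP[] // bP.
by have := pi_G_part bP (mem_block xi); move: xp; rewrite !inE => /orP[]/eqP->.
Qed.

Lemma block_G x : part_of x \in [:: 2; 5]%N -> block x \in pi_G D /\ x \in block x.
Proof.
move=> xp; have xi : x \in E_int D.
  by rewrite in_int in_ext; move: xp; rewrite !inE => /orP[]/eqP->.
split; last exact: mem_block.
have := block_pi xi; rewrite inE => /orP[] // bP.
by have := pi_F_part bP (mem_block xi); move: xp; rewrite !inE => /orP[]/eqP->.
Qed.

Lemma block_G_def B x : B \in pi_G D -> x \in B -> block x = B.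
Proof. by move=> BP; apply: block_def; rewrite inE BP orbT. Qed.

Lemma tbar_uniq B x y : B \in pi_G D -> x \in B -> y \in B ->
  part_of x = 2 -> part_of y = 2 -> x = y.
Proof.
move=> BG xB yB px py; have [_ /eqP/cards1P[z zE] _] := prefey_G vP BG.
have : x \in B :&: E_tbar D by rewrite inE xB in_parts px.
have : y \in B :&: E_tbar D by rewrite inE yB in_parts py.
by rewrite zE !inE => /eqP-> /eqP.
Qed.

Lemma part_of_rho_s : part_of (rho_s D ord0) = 1%N.
Proof.
have [_ rhoE] := prefey_rho_s vP.
have : rho_s D ord0 \in rho_s D @: [set: 'I_1] by apply: imset_f; rewrite inE.
by rewrite rhoE inE in_parts => /andP[_ /eqP].
Qed.

Lemma part_of_s x : part_of x = 1%N -> x = rho_s D ord0.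
Proof.
move=> px; have [_ rhoE] := prefey_rho_s vP.
have : x \in E_ext D :&: E_s D by rewrite inE in_ext in_parts px.
by rewrite -rhoE => /imsetP[k _ ->]; rewrite ord1.
Qed.

Lemma part_of_rho_ubar nu : part_of (rho_ubar D nu) = 4.
Proof.
have [_ rhoE] := prefey_rho_ubar vP.
have : rho_ubar D nu \in rho_ubar D @: [set: 'I_d] by apply: imset_f; rewrite inE.
by rewrite rhoE inE in_parts => /andP[_ /eqP].
Qed.

Lemma part_of_ubar x : part_of x = 4 -> exists nu, x = rho_ubar D nu.
Proof.
move=> px; have [_ rhoE] := prefey_rho_ubar vP.
have : x \in E_ext D :&: E_ubar D by rewrite inE in_ext in_parts px.
by rewrite -rhoE => /imsetP[nu _ ->]; exists nu.
Qed.

(** As every element of [E_ubar] is labelled and [C_u] is a bijection, the legs enumerate [E_u]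
    without repetition. *)
Definition leg nu : E := C_u D (rho_ubar D nu).

Lemma part_of_leg nu : part_of (leg nu) = 5.
Proof.
have [_ _ _ [_ CE]] := vD; apply/eqP; rewrite -in_u -CE.
by apply: imset_f; rewrite in_ubar part_of_rho_ubar.
Qed.

Lemma part_of_u x : part_of x = 5 -> exists nu, x = leg nu.
Proof.
have [_ _ _ [_ CE]] := vD; move/eqP; rewrite -in_u -CE => /imsetP[y].
by rewrite in_ubar => /eqP/part_of_ubar[nu ->] ->; exists nu.
Qed.

Lemma leg_inj : injective leg.
Proof.
move=> nu nu'; have [_ _ _ [CI _]] := vD.
move/CI; rewrite !in_ubar !part_of_rho_ubar => /(_ isT isT).
by have [rI _] := prefey_rho_ubar vP; apply: rI; rewrite inE.
Qed.

Lemma leg_block nu : block (leg nu) \in pi_G D /\ leg nu \in block (leg nu).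
Proof. by apply: block_G; rewrite part_of_leg. Qed.

Definition tbar_of nu : E :=
  odflt (rho_s D ord0) [pick x in block (leg nu) :&: E_tbar D].

Lemma tbar_ofP nu : tbar_of nu \in block (leg nu) /\ part_of (tbar_of nu) = 2.
Proof.
rewrite /tbar_of; case: pickP => [x | no].
  by rewrite inE in_parts => /andP[xb /eqP].
have [_ /eqP/cards1P[z zE] _] := prefey_G vP (leg_block nu).1.
by have := no z; rewrite zE inE eqxx.
Qed.

Definition legs B : {set 'I_d} := [set nu | leg nu \in B].

Definition leg_partition : {set {set 'I_d}} := [set legs B | B in pi_G D].

Lemma legs_block nu : nu \in legs (block (leg nu)).
Proof. by rewrite inE (leg_block nu).2. Qed.

Lemma pi_G_leg B : B \in pi_G D -> exists nu, nu \in legs B.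
Proof.
move=> BG; have [_ _ /set0Pn[x]] := prefey_G vP BG.
rewrite inE in_u => /andP[xB /eqP/part_of_u[nu xE]].
by exists nu; rewrite inE -xE.
Qed.

Lemma mem_legs B nu : B \in pi_G D -> (nu \in legs B) = (block (leg nu) == B).
Proof.
move=> BG; rewrite inE; apply/idP/eqP => [|<-]; first exact: block_G_def.
exact: (leg_block nu).2.
Qed.

Lemma leg_partitionP : partition leg_partition [set: 'I_d].
Proof.
apply/and3P; split.
- rewrite -subTset; apply/subsetP => nu _; apply/bigcupP.
  exists (legs (block (leg nu))); last exact: legs_block.
  by apply: imset_f; have [] := leg_block nu.
- apply/trivIsetP => _ _ /imsetP[B BG ->] /imsetP[B' BG' ->] neq.
  rewrite disjoint_subset; apply/subsetP => nu; rewrite mem_legs // => /eqP E1.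
  rewrite inE mem_legs //; apply: contraNN neq => /eqP E2.
  by rewrite -E1 E2.
apply/negP => /imsetP[B BG] /setP legs0.
by have [nu] := pi_G_leg BG; rewrite -legs0 inE.
Qed.

Lemma leg_partition_block nu (A : {set 'I_d}) : A \in leg_partition -> nu \in A ->
  A = legs (block (leg nu)).
Proof.
by move=> /imsetP[B BG ->]; rewrite mem_legs // => /eqP->.
Qed.

Lemma sbar_uniq x y : part_of x = 0%N -> part_of y = 0%N -> x = y.
Proof.
move=> px py; have [_ [CI CE] _ _] := vD.
apply: CI; rewrite ?in_parts ?px ?py //.
have Cs z : part_of z = 0%N -> C_s D z = rho_s D ord0.
  move=> pz; apply: part_of_s; apply/eqP; rewrite -in_s -CE.
  by apply: imset_f; rewrite in_sbar pz.
by rewrite !Cs.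
Qed.

Lemma sbar_ex : exists x, part_of x = 0%N.
Proof.
have [_ [_ CE] _ _] := vD.
have : rho_s D ord0 \in E_s D by rewrite in_s part_of_rho_s.
by rewrite -CE => /imsetP[x]; rewrite in_sbar => /eqP px _; exists x.
Qed.

(** A block of [pi_F] contains an element of [E_sbar], and there is only one such element; so one
    block holds all of [E_sbar] and [E_t]. *)
Lemma pi_FE : pi_F D = [set [set x | part_of x \in [:: 0; 3]%N]].
Proof.
have [x0 px0] := sbar_ex.
have [b0F x0b] : block x0 \in pi_F D /\ x0 \in block x0 by apply: block_F; rewrite px0.
have FE B : B \in pi_F D -> B = block x0.
  move=> BF; have [_ /eqP/cards1P[z zE] _] := prefey_F vP BF.
  have : z \in B :&: E_sbar D by rewrite zE inE.
  rewrite inE in_sbar => /andP[zB /eqP pz].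
  by rewrite (sbar_uniq px0 pz); apply/esym/block_def; rewrite // inE BF.
apply/setP => B; rewrite inE; have <- : block x0 = [set x | part_of x \in [:: 0; 3]%N].
  apply/setP => x; rewrite [RHS]inE; apply/idP/idP => [|/block_F[bF xb]].
    exact: pi_F_part.
  by rewrite -(FE _ bF).
by apply/idP/eqP => [/FE | ->].
Qed.

Lemma C_t_part x : part_of x = 2 -> part_of (C_t D x) = 3.
Proof.
have [_ _ [_ CE] _] := vD; move=> px; apply/eqP; rewrite -in_t -CE.
by apply: imset_f; rewrite in_tbar px.
Qed.

Lemma part_of_t x : part_of x = 3 -> exists2 y, part_of y = 2 & x = C_t D y.
Proof.
have [_ _ [_ CE] _] := vD; move/eqP; rewrite -in_t -CE => /imsetP[y].
by rewrite in_tbar => /eqP py ->; exists y.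
Qed.

(** A block of [pi_G] contains some leg and only one element of [E_tbar], which the leg therefore
    identifies. *)
Lemma tbar_leg x : part_of x = 2 -> exists2 nu, x = tbar_of nu & block x = block (leg nu).
Proof.
move=> px; have [bG xb] : block x \in pi_G D /\ x \in block x by apply: block_G; rewrite px.
have [nu] := pi_G_leg bG; rewrite mem_legs // => /eqP bE.
exists nu => //; have [tb pt] := tbar_ofP nu.
by apply: (tbar_uniq bG); rewrite -?bE // bE.
Qed.

Lemma block_tbar_of nu : block (tbar_of nu) = block (leg nu).
Proof. by apply: block_G_def; [have [] := leg_block nu | have [] := tbar_ofP nu]. Qed.

Lemma C_t_inj x y : part_of x = 2 -> part_of y = 2 -> C_t D x = C_t D y -> x = y.
Proof. by move=> px py; have [_ _ [CI _] _] := vD; apply: CI; rewrite in_tbar ?px ?py. Qed.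

Lemma tbar_of_eq nu nu' : block (leg nu) = block (leg nu') -> tbar_of nu = tbar_of nu'.
Proof. by rewrite /tbar_of => ->. Qed.

Lemma fey_aut_trivial : #|fey_aut D| = 1%N.
Proof.
rewrite (_ : fey_aut D = [set 1%g]) ?cards1 //; apply/setP => tau.
rewrite !inE; apply/asboolP/eqP => [[tD tCs tCt tCu] | ->]; last first.
  have im1 (A : {set E}) : (1%g : {perm E}) @: A = A.
    by rewrite -[RHS]imset_id; apply: eq_imset => x; rewrite perm1.
  split; try by move=> x _; rewrite !perm1.
  rewrite /prefey_map; case: (fey_pre D) => *; congr PreFey => //=;
    try by rewrite -[RHS]imset_id; apply: eq_imset => x; rewrite im1.
  - by apply/ffunP => k; rewrite ffunE perm1.
  - by apply/ffunP => k; rewrite ffunE perm1.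
have rho_fix nu : tau (rho_ubar D nu) = rho_ubar D nu.
  by rewrite -[in RHS]tD ffunE.
have leg_fix nu : tau (leg nu) = leg nu.
  by rewrite /leg -tCu ?rho_fix // in_ubar part_of_rho_ubar.
have part_tau r x : (r < 6)%N -> part_of x = r -> part_of (tau x) = r.
  move=> r6 /eqP; rewrite -mem_parts // => xr; apply/eqP; rewrite -mem_parts //.
  rewrite /parts -tD /=; case: r r6 xr => [|[|[|[|[|[|]]]]]] //= _ xr; exact: imset_f.
(* The block of [x] contains a fixed leg, so [tau] maps it to itself and fixes its only element of
   [E_tbar]. *)
have tbar_fix x : part_of x = 2 -> tau x = x.
  move=> px; have [nu xE bE] := tbar_leg px.
  have [bG xb] : block x \in pi_G D /\ x \in block x by apply: block_G; rewrite px.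
  have tbG : tau @: block x \in pi_G D by rewrite -[in pi_G _]tD; apply: imset_f.
  have lb : leg nu \in block x by rewrite bE; have [] := leg_block nu.
  have bb : tau @: block x = block x.
    rewrite -(block_G_def tbG (imset_f tau lb)) leg_fix.
    exact: block_G_def bG lb.
  by apply: (tbar_uniq bG) => //; [rewrite -bb; apply: imset_f | apply: part_tau].
apply/permP => x; rewrite perm1.
case px: (part_of x) (part_of_lt x) => [|[|[|[|[|[|]]]]]] //= _.
- by apply: sbar_uniq => //; apply: part_tau.
- by rewrite (part_of_s px); rewrite -[in RHS]tD ffunE.
- exact: tbar_fix.
- by have [y py ->] := part_of_t px; rewrite -tCt ?tbar_fix // in_tbar py.
- by have [nu ->] := part_of_ubar px.
by have [nu ->] := part_of_u px.
Qed.

End ValidDiagram.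

(** * Diagrams from set partitions *)

Section StandardDiagram.
Local Open Scope nat_scope.
Variables (d : nat) (P : {set {set 'I_d}}).
Hypotheses (d_gt0 : 0 < d) (partP : partition P [set: 'I_d]).

Let Q : finType := {A : {set 'I_d} | A \in P}.

(* The pair [(z, false)] is contracted with [(z, true)]; [None] stands for the
   root, [inl nu] for the [nu]-th external leg, [inr A] for the block [A]. *)
Definition std_set : finType := (option ('I_d + Q) * bool)%type.

(** The numbering agrees with [part_of]; the boolean adds 1 when passing from an element to its
    contraction partner. *)
Definition std_part (x : std_set) : nat :=
  match x with
  | (None, b) => b
  | (Some (inr _), b) => 2 + b
  | (Some (inl _), b) => 4 + b
  end.

Definition std_block (A : Q) : {set std_set} :=
  [set x : std_set | match x with
                     | (Some (inr A'), false) => A' == A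
                     | (Some (inl nu), true) => nu \in val A
                     | _ => false
                     end].

Let part r : {set std_set} := [set x | std_part x == r].

Definition std_prefey : prefey d std_set :=
  PreFey (part 0) (part 1) (part 2) (part 3) (part 4) (part 5)
    [set x | std_part x \notin [:: 1; 4]] [set x | std_part x \in [:: 1; 4]]
    [set [set x | std_part x \in [:: 0; 3]]] [set std_block A | A : Q]
    [ffun _ : 'I_1 => (None, true) : std_set]
    [ffun nu : 'I_d => (Some (inl nu), false) : std_set].

Definition std_fey : fey d std_set :=
  let C := [ffun x : std_set => (x.1, true) : std_set] in Fey std_prefey C C C.

Lemma std_part_lt x : std_part x < 6.
Proof. by case: x => [[[?|?]|] []]. Qed.

Lemma disjoint_part r r' : r != r' -> [disjoint part r & part r'].
Proof.
move=> rr'; rewrite disjoint_subset; apply/subsetP => x; rewrite !inE => /eqP->.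
exact: rr'.
Qed.

Lemma std_block_part A x : x \in std_block A -> std_part x \in [:: 2; 5].
Proof. by rewrite inE; case: x => [[[?|?]|] []]. Qed.

Lemma std_block_neq0 (A : Q) : exists nu, nu \in val A.
Proof. by apply/set0Pn/(partition_neq0 partP); apply: valP. Qed.

Lemma std_tbar_mem (A : Q) : (Some (inr A), false) \in std_block A.
Proof. by rewrite inE eqxx. Qed.

Lemma std_block_inj : injective std_block.
Proof. by move=> A B AB; have := std_tbar_mem A; rewrite AB inE => /eqP. Qed.

Lemma std_block_of nu : {A : Q | nu \in val A}.
Proof.
have cov : nu \in cover P by rewrite (cover_partition partP) inE.
by exists (Sub (pblock P nu) (pblock_mem cov)); rewrite SubK mem_pblock.
Qed.

Lemma std_is_fey : is_fey std_fey.
Proof.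
have contract r : r \in [:: 0; 2; 4] ->
    is_bij_onto [ffun x : std_set => (x.1, true) : std_set] (part r) (part r.+1).
  move=> r024; split=> [[z b] [z' b'] | ].
    rewrite !inE !ffunE /= => p p' [zz']; subst z'; congr (_, _).
    by move: r024 p p'; rewrite !inE => /or3P[]/eqP->; case: z b b' => [[?|?]|] [] [].
  apply/setP => x; apply/imsetP/idP => [[y yr ->] | ].
    move: yr r024; rewrite ffunE !inE => /eqP<-.
    by case: y => [[[?|?]|] []].
  case: x => z b xr; exists (z, false); rewrite ?ffunE; last first.
    by move: xr r024; rewrite !inE => /eqP E /or3P[]/eqP E'; move: E; rewrite E';
      case: z b => [[?|?]|] [].
  by move: xr r024; rewrite !inE => /eqP E /or3P[]/eqP E'; move: E; rewrite E';
      case: z b => [[?|?]|] [].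
split; [|exact: (@contract 0) | exact: (@contract 2) | exact: (@contract 4)].
have F_part x : (x \in [set x : std_set | std_part x \in [:: 0; 3]]) =
    (std_part x == 0) || (std_part x == 3) by rewrite !inE.
have G_disj A : [set x : std_set | std_part x \in [:: 0; 3]] :&: std_block A = set0.
  apply/setP => x; rewrite in_setI in_set0 F_part; apply/negP => /andP[x03 /std_block_part].
  by rewrite !inE; case/orP: x03 => /eqP->.
constructor => /=.
- split=> [k k' _ _ _ | ]; first by rewrite !ord1.
  apply/setP => x; apply/imsetP/idP => [[k _ ->] | ]; first by rewrite !inE ffunE.
  by rewrite !inE => /andP[_]; case: x => [[[?|?]|] []] // _; exists ord0; rewrite ?inE ?ffunE.
- split=> [nu nu' _ _ | ]; first by rewrite !ffunE => -[].
  apply/setP => x; apply/imsetP/idP => [[k _ ->] | ]; first by rewrite !inE ffunE.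
  by rewrite !inE => /andP[_]; case: x => [[[nu|?]|] []] // _; exists nu; rewrite ?inE ?ffunE.
- by rewrite !disjoint_part.
- apply/setP => x; have := std_part_lt x; rewrite !inE.
  by case: (std_part x) => [|[|[|[|[|[|]]]]]].
- by rewrite disjoint_subset; apply/subsetP => x; rewrite !inE.
- by apply/setP => x; rewrite !inE orNb.
- apply/setP => x; have := std_part_lt x; rewrite !inE.
  by case: (std_part x) => [|[|[|[|[|[|]]]]]].
- rewrite disjoints1; apply/negP => /imsetP[A _ FA].
  by have := std_tbar_mem A; rewrite -FA inE.
- apply/and3P; split.
  + apply/eqP/setP => x; rewrite inE; apply/bigcupP/idP => [[B] | ].
      rewrite !inE => /orP[/eqP-> | /imsetP[A _ ->]].
        by rewrite F_part => /orP[]/eqP->.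
      by move/std_block_part; rewrite !inE => /orP[]/eqP->.
    case: x => [[[nu|A]|] []] // _.
    * have [A nuA] := std_block_of nu; exists (std_block A); last by rewrite inE.
      by rewrite !inE imset_f ?orbT.
    * by exists [set x | std_part x \in [:: 0; 3]]; rewrite !inE ?eqxx.
    * exists (std_block A); last by rewrite inE.
      by rewrite !inE imset_f ?orbT.
    by exists [set x | std_part x \in [:: 0; 3]]; rewrite !inE ?eqxx.
  + apply/trivIsetP => B B'; rewrite !inE => /orP[/eqP-> | /imsetP[A _ ->]] /orP[/eqP-> | /imsetP[A' _ ->]].
    * by rewrite eqxx.
    * by rewrite -setI_eq0 G_disj eqxx.
    * by rewrite -setI_eq0 setIC G_disj eqxx.
    move=> neq; rewrite disjoint_subset; apply/subsetP => x xA; rewrite inE; apply/negP => xA'.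
    case/negP: neq; apply/eqP; congr std_block.
    move: xA xA'; rewrite !inE; case: x => [[[nu|A'']|] []] //; last by move=> /eqP<- /eqP.
    move=> nuA nuA'; apply: val_inj; have triv := partition_trivIset partP.
    by rewrite -(def_pblock triv (valP A) nuA) -(def_pblock triv (valP A') nuA').
  rewrite !inE negb_or; apply/andP; split.
    by apply/eqP => /setP/(_ (None, false)); rewrite !inE.
  by apply/negP => /imsetP[A _ /setP/(_ (Some (inr A), false))]; rewrite std_tbar_mem inE.
- move=> B; rewrite inE => /eqP->; split.
  + by apply/setP => x; rewrite !inE; case: (std_part x) => [|[|[|[|]]]].
  + rewrite (_ : _ :&: _ = [set (None, false)]) ?cards1 //.
    by apply/setP => x; rewrite !inE; case: x => [[[?|?]|] []].
  (* The vertex in [pi_F] needs an element of [E_t]: a label exists because [d] is positive, and its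
     block in [P] provides one. *)
  have [A _] := std_block_of (Ordinal d_gt0).
  by apply/set0Pn; exists (Some (inr A), true); rewrite !inE.
move=> B /imsetP[A _ ->]; split.
- apply/setP => x; rewrite in_setU !in_setI -andb_orr andb_idr // => /std_block_part.
  by rewrite !inE.
- rewrite (_ : _ :&: _ = [set (Some (inr A), false)]) ?cards1 //.
  by apply/setP => x; rewrite !inE; case: x => [[[?|?]|] []]; rewrite /= ?xpair_eqE ?andbF ?andbT.
by have [nu nuA] := std_block_neq0 A; apply/set0Pn; exists (Some (inl nu), true); rewrite !inE nuA.
Qed.

Definition std_diagram : diagram d := Diagram std_is_fey.

Lemma std_leg_partition : leg_partition std_fey = P.
Proof.
have legsE A : legs std_fey (std_block A) = val A.
  apply/setP => nu; rewrite inE (_ : leg std_fey nu = (Some (inl nu), true)) ?inE //.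
  by rewrite /leg /= !ffunE.
apply/setP => A; apply/imsetP/idP => [[_ /imsetP[B _ ->] ->] | AP].
  by rewrite legsE; apply: valP.
by exists (std_block (Sub A AP)); rewrite ?legsE ?SubK ?imset_f.
Qed.

End StandardDiagram.

(** * Every diagram is equivalent to the standard diagram of its leg partition *)

Section Chart.
Local Open Scope nat_scope.
Variables (d : nat) (E : finType) (D : fey d E).
Hypothesis vD : is_fey D.

Let P := leg_partition D.

Definition chart_tbar (A : {set 'I_d}) : E :=
  if [pick nu in A] is Some nu then tbar_of D nu else rho_s D ord0.

Definition chart_sbar : E := odflt (rho_s D ord0) [pick x | part_of D x == 0].

(** The map is forced: labels determine the external elements, [C_u] the legs, a block with its legs
    its [tbar] element, and [C_t] the rest; the [sbar] element is unique. *)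
Definition chart (x : std_set P) : E :=
  match x with
  | (None, false) => chart_sbar
  | (None, true) => rho_s D ord0
  | (Some (inr A), false) => chart_tbar (val A)
  | (Some (inr A), true) => C_t D (chart_tbar (val A))
  | (Some (inl nu), false) => rho_ubar D nu
  | (Some (inl nu), true) => leg D nu
  end.

Lemma chart_tbarE A nu : A \in P -> nu \in A -> chart_tbar A = tbar_of D nu.
Proof.
move=> AP nuA; rewrite /chart_tbar; case: pickP => [nu' nuA' | /(_ nu)]; last by rewrite nuA.
apply: tbar_of_eq; move: nuA'; rewrite (leg_partition_block vD AP nuA).
by rewrite mem_legs ?(leg_block vD nu).1 // => /eqP.
Qed.

Lemma chart_tbarP A : A \in P ->
  [/\ part_of D (chart_tbar A) = 2, block D (chart_tbar A) \in pi_G D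
    & legs D (block D (chart_tbar A)) = A].
Proof.
move=> AP; have /set0Pn[nu nuA] : A != set0.
  by apply: partition_neq0 (leg_partitionP vD) AP.
rewrite (chart_tbarE AP nuA) (block_tbar_of vD) -(leg_partition_block vD AP nuA).
by split=> //; [have [] := tbar_ofP vD nu | have [] := leg_block vD nu].
Qed.

Lemma part_of_chart x : part_of D (chart x) = std_part x.
Proof.
case: x => [[[nu|A]|] []] /=.
- exact: part_of_leg.
- exact: part_of_rho_ubar.
- by apply: C_t_part => //; have [] := chart_tbarP (valP A).
- by have [] := chart_tbarP (valP A).
- exact: part_of_rho_s.
rewrite /chart_sbar; case: pickP => [x /eqP // | no].
by have [x px] := sbar_ex vD; have := no x; rewrite px.
Qed.

Lemma chart_tbar_inj A B : A \in P -> B \in P -> chart_tbar A = chart_tbar B -> A = B.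
Proof.
by move=> AP BP AB; have [_ _ <-] := chart_tbarP AP; have [_ _ <-] := chart_tbarP BP; rewrite AB.
Qed.

Lemma chart_inj : injective chart.
Proof.
(* Preservation of the part leaves only pairs [x], [y] of the same kind. *)
move=> x y xy; have pxy : std_part x = std_part y by rewrite -!part_of_chart xy.
case: x y xy pxy => [[[nu|A]|] []] [[[nu'|B]|] []] //= xy _.
- by rewrite (leg_inj vD xy).
- have vP : is_prefey D by case: vD.
  have [rI _] := prefey_rho_ubar vP.
  by rewrite (rI nu nu' _ _ xy) ?inE.
- have [pA _ _] := chart_tbarP (valP A); have [pB _ _] := chart_tbarP (valP B).
  by have /val_inj -> := chart_tbar_inj (valP A) (valP B) (C_t_inj vD pA pB xy).
by have /val_inj -> := chart_tbar_inj (valP A) (valP B) xy.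
Qed.

Lemma chart_tbar_surj y : part_of D y = 2 -> exists A : {A | A \in P}, y = chart_tbar (val A).
Proof.
move=> py; have [nu yE bE] := tbar_leg vD py.
have AP : legs D (block D (leg D nu)) \in P by apply: imset_f; have [] := leg_block vD nu.
exists (exist (fun A => A \in P) _ AP); rewrite yE; apply/esym/chart_tbarE => //.
exact: legs_block.
Qed.

Lemma chart_surj y : exists x, y = chart x.
Proof.
case py: (part_of D y) (part_of_lt vD y) => [|[|[|[|[|[|]]]]]] //= _.
- by exists (None, false); apply: (sbar_uniq vD py); rewrite part_of_chart.
- by exists (None, true); apply: (part_of_s vD py).
- by have [A ->] := chart_tbar_surj py; exists (Some (inr A), false).
- have [z pz ->] := part_of_t vD py; have [A ->] := chart_tbar_surj pz.
  by exists (Some (inr A), true).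
- by have [nu ->] := part_of_ubar vD py; exists (Some (inl nu), false).
by have [nu ->] := part_of_u vD py; exists (Some (inl nu), true).
Qed.

Lemma chart_bij : bijective chart.
Proof.
pose g y := odflt (None, true) [pick x | chart x == y].
have gK y : chart (g y) = y.
  rewrite /g; case: pickP => [x /eqP // | no].
  by have [x yE] := chart_surj y; have := no x; rewrite yE eqxx.
by exists g => // x; apply: chart_inj; rewrite gK.
Qed.

Lemma chart_im (p : pred E) (q : pred (std_set P)) : (forall x, p (chart x) = q x) ->
  chart @: [set x | q x] = [set y | p y].
Proof.
move=> pq; apply/setP => y; apply/imsetP/idP => [[x] | ]; first by rewrite !inE -pq => ? ->.
by have [x ->] := chart_surj y; rewrite inE pq => qx; exists x; rewrite ?inE.
Qed.

Lemma chart_im_part r : r < 6 ->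
  chart @: [set x | std_part x == r] = nth set0 (parts D) r.
Proof.
move=> r6; rewrite (chart_im (p := fun y => part_of D y == r)); last first.
  by move=> x; rewrite part_of_chart.
by apply/setP => y; rewrite inE mem_parts.
Qed.

Lemma chart_block (A : {A | A \in P}) :
  chart @: std_block A = block D (chart_tbar (val A)).
Proof.
have [pA bG bA] := chart_tbarP (valP A).
rewrite (chart_im (p := fun y => y \in block D (chart_tbar (val A)))) ?set_mem_id //; last first.
  move=> x; have := part_of_chart x; case: x => [[[nu|B]|] []] /= px.
  - by rewrite -[in RHS]bA inE.
  - by apply/negP => /(pi_G_part vD bG); rewrite px.
  - by apply/negP => /(pi_G_part vD bG); rewrite px.
  - have [pB _ bB] := chart_tbarP (valP B).
    apply/idP/eqP => [Bb | ->].
      by apply: val_inj; rewrite -bB -bA -(block_G_def vD bG Bb).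
    by have [|] := @block_G _ _ _ vD (chart_tbar (val A)); rewrite ?pA.
  - by apply/negP => /(pi_G_part vD bG); rewrite px.
  by apply/negP => /(pi_G_part vD bG); rewrite px.
by apply/setP => y; rewrite inE.
Qed.

Lemma chart_transports : fey_transports chart (std_fey P) D.
Proof.
have vP : is_prefey D by case: vD.
have C_sE x : part_of D x = 0 -> C_s D x = rho_s D ord0.
  have [_ [_ CE] _ _] := vD.
  move=> px; apply: (part_of_s vD); apply/eqP; rewrite -in_s // -CE.
  by apply: imset_f; rewrite in_sbar // px.
split.
- rewrite /prefey_map /=.
  have -> : chart @: [set x | std_part x \notin [:: 1; 4]] = E_int D.
    rewrite (chart_im (p := fun y => part_of D y \notin [:: 1; 4])); last first.
      by move=> x; rewrite part_of_chart.
    by apply/setP => y; rewrite inE in_int // in_ext.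
  have -> : chart @: [set x | std_part x \in [:: 1; 4]] = E_ext D.
    rewrite (chart_im (p := fun y => part_of D y \in [:: 1; 4])); last first.
      by move=> x; rewrite part_of_chart.
    by apply/setP => y; rewrite inE in_ext.
  have -> : [set chart @: (B : {set std_set P}) |
      B in [set [set x : std_set P | std_part x \in [:: 0; 3]]]] = pi_F D.
    rewrite imset_set1 (pi_FE vD); congr [set _].
    by apply: chart_im => x; rewrite part_of_chart.
  have -> : [set chart @: (B : {set std_set P}) | B in [set std_block A | A : {A | A \in P}]] = pi_G D.
    apply/setP => B; apply/imsetP/idP => [[_ /imsetP[A _ ->] ->] | BG].
      by rewrite chart_block; have [] := chart_tbarP (valP A).
    have AP : legs D B \in P by apply: imset_f.
    exists (std_block (exist (fun A => A \in P) _ AP)); first exact: imset_f.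
    have [nu nuB] := pi_G_leg vD BG; rewrite chart_block /= (chart_tbarE AP nuB).
    by rewrite (block_tbar_of vD); move: nuB; rewrite mem_legs // => /eqP->.
  have -> : [ffun k => chart ([ffun=> (None, true)] k)] = rho_s D.
    by apply/ffunP => k; rewrite !ffunE ord1.
  have -> : [ffun nu => chart ([ffun nu0 => (Some (inl nu0), false)] nu)] = rho_ubar D.
    by apply/ffunP => k; rewrite !ffunE.
  rewrite !chart_im_part //= /parts /=.
  by case: (fey_pre D).
- by move=> x; rewrite inE => /eqP p0; rewrite ffunE C_sE ?part_of_chart //; case: x p0 => [[[?|?]|] []].
- by move=> x; rewrite inE ffunE; case: x => [[[?|?]|] []].
by move=> x; rewrite inE ffunE; case: x => [[[?|?]|] []].
Qed.

End Chart.

(** * Amplitudes and conclusion *)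

Section Transport.
Variables (d : nat) (E E' : finType) (D : fey d E) (D' : fey d E') (sg : E -> E').
Hypotheses (sg_bij : bijective sg) (sgD : fey_transports sg D D').

Lemma leg_partition_transport : is_fey D -> leg_partition D = leg_partition D'.
Proof.
move=> vD; have [tD _ _ tCu] := sgD; have sg_inj := bij_inj sg_bij.
have legE nu : leg D' nu = sg (leg D nu).
  by rewrite /leg -tCu ?in_ubar // ?part_of_rho_ubar // -tD ffunE.
have legsE (B : {set E}) : legs D' (sg @: B) = legs D B.
  by apply/setP => nu; rewrite !inE legE mem_imset.
apply/setP => A; apply/imsetP/imsetP => [[B BG ->] | [B']].
  by exists (sg @: B); rewrite ?legsE // -tD; apply: imset_f.
by rewrite -tD => /imsetP[B BG ->] ->; exists B; rewrite ?legsE.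
Qed.

Lemma amplitude_transport (n : nat) (R : comAlgType rat) (F G : 'I_n -> fps 'I_n R)
    (tau_s : 'I_1 -> 'I_n) (tau_ubar : 'I_d -> 'I_n) :
  amplitude F G tau_s tau_ubar D' = amplitude F G tau_s tau_ubar D.
Proof.
have [tD tCs tCt tCu] := sgD; have sg_inj := bij_inj sg_bij; have [sgi sgK sgiK] := sg_bij.
pose pull (al : {ffun E' -> 'I_n}) : {ffun E -> 'I_n} := [ffun x => al (sg x)].
pose push (al : {ffun E -> 'I_n}) : {ffun E' -> 'I_n} := [ffun x => al (sgi x)].
have weight H (al : {ffun E' -> 'I_n}) (X Y B : {set E}) :
    vertex_weight H al (sg @: B :&: sg @: X) (sg @: B :&: sg @: Y) =
    vertex_weight H (pull al) (B :&: X) (B :&: Y) :> R.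
  rewrite -!imsetI; try by move=> ? ? _ _; apply: sg_inj.
  rewrite /vertex_weight big_imset /=; last by move=> ? ? _ _; apply: sg_inj.
  apply: eq_bigr => x _; rewrite ffunE.
  transitivity (fps_deriv0 (H (al (sg x))) [seq al y | y <- [seq sg y | y <- enum (B :&: Y)]]).
    (* [sg] need not respect the enumeration order of a block, but iterated derivatives are
       symmetric. *)
    apply/fps_deriv0_perm/perm_map/uniq_perm; rewrite ?map_inj_uniq ?enum_uniq // => y.
    rewrite mem_enum; apply/imsetP/mapP => -[z zB ->]; exists z => //; by rewrite mem_enum in zB *.
  by rewrite -map_comp; congr fps_deriv0; apply: eq_map => y; rewrite /= ffunE.
have im_inj : injective (fun B : {set E} => sg @: B) by apply: imset_inj.
rewrite /amplitude (reindex_onto push pull) /=; last first.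
  by move=> al _; apply/ffunP => x; rewrite !ffunE sgiK.
have pushE al x : push al (sg x) = al x by rewrite ffunE sgK.
have pushK al : pull (push al) = al by apply/ffunP => x; rewrite ffunE pushE.
apply: eq_big => al.
  rewrite pushK eqxx andbT /index_attribution -tD /=.
  by congr (_ && _); apply: eq_forallb => k; rewrite [X in push al X]ffunE pushE.
move=> _; rewrite -tD /= !big_imset; try by move=> ? ? _ _; first [apply: sg_inj | apply: im_inj].
congr (_ * _ * _ * _ * _).
- by apply: eq_bigr => x xs; rewrite tCs // !pushE.
- by apply: eq_bigr => x xs; rewrite tCt // !pushE.
- by apply: eq_bigr => x xs; rewrite tCu // !pushE.
- by apply: eq_bigr => B _; rewrite weight pushK.
by apply: eq_bigr => B _; rewrite weight pushK.
Qed.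

End Transport.

Lemma dia_equiv_sym d (D D' : diagram d) : dia_equiv D D' -> dia_equiv D' D.
Proof.
case=> sg sg_bij [tD tCs tCt tCu]; have [sgi sgK sgiK] := sg_bij.
exists sgi; first by exists sg.
have imK (A : {set dia_set D}) : sgi @: (sg @: A) = A.
  by rewrite -imset_comp -[RHS]imset_id; apply: eq_imset.
have imsK (S : {set {set dia_set D}}) :
    [set sgi @: (B : {set dia_set D'}) | B in [set sg @: (B : {set dia_set D}) | B in S]] = S.
  by rewrite -imset_comp -[RHS]imset_id; apply: eq_imset => B /=; rewrite imK.
split.
- rewrite -tD /prefey_map /= !imsK !imK; case: (fey_pre (dia_fey D)) => * /=.
  by congr PreFey; apply/ffunP => k; rewrite !ffunE sgK.
- by rewrite -tD => x /imsetP[y ys ->]; rewrite tCs // !sgK.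
- by rewrite -tD => x /imsetP[y ys ->]; rewrite tCt // !sgK.
by rewrite -tD => x /imsetP[y ys ->]; rewrite tCu // !sgK.
Qed.

Lemma prodr_nat_bool (I : finType) (R : comAlgType rat) (A : {set I}) (p : pred I) :
  \prod_(x in A) (p x)%:R = [forall x in A, p x]%:R :> R.
Proof.
case: (boolP [forall x in A, p x]) => [/forall_inP Ap | /forall_inPn[x xA px]].
  by rewrite big1 // => x xA; rewrite Ap.
by rewrite (bigD1 x) //= (negPf px) mul0r.
Qed.

(** * The amplitude of a standard diagram is a Faa di Bruno term *)

Section StandardAmplitude.
Variables (n d : nat) (R : comAlgType rat) (F G : 'I_n -> fps 'I_n R).
Variables (i : 'I_n) (j : 'I_d -> 'I_n) (P : {set {set 'I_d}}).

Let Q := {A : {set 'I_d} | A \in P}.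
Let St := std_set P.

Let ext (ka : {ffun {set 'I_d} -> 'I_n}) : {ffun St -> 'I_n} :=
  [ffun x : St => match x.1 with
                  | None => i
                  | Some (inl nu) => j nu
                  | Some (inr A) => ka (val A)
                  end].

(** The value [i] outside of [P] is the default passed as [k0] to [faa_term], so [rst] lands in the
    functions supported on [P]. *)
Let rst (al : {ffun St -> 'I_n}) : {ffun {set 'I_d} -> 'I_n} :=
  [ffun A => if insub A is Some B then al (Some (inr B), false) else i].

Lemma rst_val al (A : Q) : rst al (val A) = al (Some (inr A), false).
Proof. by rewrite ffunE valK. Qed.

Lemma perm_map_val_enum : perm_eq [seq val A | A <- enum {: Q}] (enum P).
Proof.
apply: uniq_perm; [by rewrite (map_inj_uniq val_inj) enum_uniq | exact: enum_uniq | move=> A].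
rewrite mem_enum; apply/mapP/idP => [[B _ ->] | AP]; first exact: valP.
by exists (Sub A AP); rewrite ?mem_enum ?SubK.
Qed.

(** Labels and contractions leave one free index per block of [P], the function [ka] of [faa_term].
    The [F] vertex differentiates [F i] once per block in these directions, and the vertex of [A]
    differentiates [G (ka A)] along the labels in [A]. *)
Lemma std_amplitude :
  amplitude F G (fun=> i) j (std_fey P) = faa_term G j i P (F i).
Proof.
pose C : {ffun St -> St} := [ffun x : St => (x.1, true)].
pose ok (al : {ffun St -> 'I_n}) := [&& index_attribution (fun=> i) j (std_fey P) al,
  [forall x in E_sbar (std_fey P), al (C x) == al x],
  [forall x in E_tbar (std_fey P), al (C x) == al x] &
  [forall x in E_ubar (std_fey P), al (C x) == al x]].
transitivity (\sum_(al : {ffun St -> 'I_n} | ok al)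
   (\prod_(B in pi_F (std_fey P))
      vertex_weight F al (B :&: E_sbar (std_fey P)) (B :&: E_t (std_fey P))) *
   (\prod_(B in pi_G (std_fey P))
      vertex_weight G al (B :&: E_tbar (std_fey P)) (B :&: E_u (std_fey P)))).
  rewrite /amplitude [RHS]big_mkcond [LHS]big_mkcond; apply: eq_bigr => al _.
  rewrite !prodr_nat_bool /ok; case: (index_attribution _ _ _ _) => //=.
  do 3![case: [forall x in _, _]; rewrite ?mul1r ?mul0r //=].
(* An admissible [al] is constant on contracted pairs and prescribed on the root and the legs, so
   its values on the [tbar] elements determine it. *)
have okP al : reflect (ext (rst al) = al) (ok al).
  apply: (iffP idP) => [/and4P[/andP[/forallP is0 /forallP iu] /forallP os /forallP ot /forallP ou] | <-].
    have alT z : al (z, true) = al (z, false).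
      have := os (z, false); have := ot (z, false); have := ou (z, false).
      rewrite !inE /C !ffunE /=.
      by case: z => [[nu|A]|] /=; [move=> /eqP | move=> _ /eqP | move=> _ _ /eqP].
    have al0 : al (None, true) = i by have := is0 ord0; rewrite ffunE => /eqP.
    have alu nu : al (Some (inl nu), false) = j nu by have := iu nu; rewrite ffunE => /eqP.
    apply/ffunP => -[[[nu|A]|] b]; rewrite [LHS]ffunE /=.
    - by case: b; rewrite ?alT alu.
    - by rewrite (rst_val al A); case: b; rewrite ?alT.
    by case: b; rewrite -?alT al0.
  apply/and4P; split; try by apply/forall_inP => x _; rewrite /C !ffunE.
  by apply/andP; split; apply/forallP => k; rewrite !ffunE.
rewrite (reindex_onto ext rst) => [|al /okP //].
rewrite /faa_term; apply: eq_big => ka.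
  have -> : ok (ext ka).
    apply/okP/ffunP => -[[[nu|A]|] b]; rewrite [LHS]ffunE [RHS]ffunE //=.
    by rewrite (rst_val _ A) ffunE.
  apply/eqP/forallP => [<- A | sup].
    by apply/implyP => AP; rewrite ffunE insubN.
  apply/ffunP => A; rewrite ffunE; case: insubP => [B _ BA | AP]; first by rewrite ffunE /= BA.
  by have := sup A; rewrite AP => /eqP.
move=> _; congr (_ * _).
  rewrite big_set1 /vertex_weight (_ : _ :&: E_sbar _ = [set (None, false)]); last first.
    by apply/setP => x; rewrite !inE; case: x => [[[?|?]|] []].
  rewrite big_set1 ffunE /=.
  pose tb (A : Q) : St := (Some (inr A), true).
  transitivity (fps_deriv0 (F i) [seq ext ka y | y <- [seq tb A | A <- enum {: Q}]]).
    apply/fps_deriv0_perm/perm_map/uniq_perm; rewrite ?enum_uniq //.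
      by rewrite map_inj_uniq ?enum_uniq // => A B [].
    move=> x; rewrite mem_enum !inE; apply/idP/mapP => [|[A _ ->] //].
    by case: x => [[[?|A]|] []] //= _; exists A; rewrite ?mem_enum.
  rewrite -map_comp (@dset_perm _ _ _ _ _ _ [seq val A | A <- enum {: Q}]); last first.
    by rewrite perm_sym perm_map_val_enum.
  by rewrite -map_comp; congr fps_deriv0; apply: eq_map => A; rewrite /= ffunE.
rewrite big_imset /=; last by move=> A B _ _; apply: std_block_inj.
rewrite -[RHS]big_enum -(perm_big _ perm_map_val_enum) big_map big_enum /=.
apply: eq_bigr => A _; rewrite /vertex_weight.
rewrite (_ : _ :&: [set x | std_part x == 2] = [set (Some (inr A), false)]); last first.
  by apply/setP => x; rewrite !inE; case: x => [[[?|?]|] []]; rewrite /= ?xpair_eqE ?andbF ?andbT.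
rewrite big_set1 ffunE /=.
pose lg (nu : 'I_d) : St := (Some (inl nu), true).
transitivity (fps_deriv0 (G (ka (val A))) [seq ext ka y | y <- [seq lg nu | nu <- enum (val A)]]).
  apply/fps_deriv0_perm/perm_map/uniq_perm; rewrite ?enum_uniq //.
    by rewrite map_inj_uniq ?enum_uniq // => ? ? [].
  move=> x; rewrite mem_enum !inE; apply/idP/mapP => [|[nu + ->] /=].
    by case: x => [[[nu|?]|] []] //=; rewrite ?andbF ?andbT // => nuA; exists nu; rewrite ?mem_enum.
  by rewrite mem_enum => ->.
by rewrite -map_comp; congr fps_deriv0; apply: eq_map => nu; rewrite /= ffunE.
Qed.

End StandardAmplitude.

Lemma leg_partition_equiv d (D D' : diagram d) : dia_equiv D D' ->
  leg_partition (dia_fey D) = leg_partition (dia_fey D').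
Proof.
by case=> sg sg_bij sgD; apply: leg_partition_transport sg_bij sgD (dia_valid D).
Qed.

(** * Equivalence classes of diagrams and set partitions *)

Section Classification.
Variables (d : nat) (d_gt0 : (0 < d)%N).

Lemma std_diagram_equiv (P : {set {set 'I_d}}) (partP : partition P [set: 'I_d]) (D : diagram d) :
  leg_partition (dia_fey D) = P -> dia_equiv (std_diagram d_gt0 partP) D.
Proof.
move=> DP; case: _ / DP partP => partP.
exists (chart (D := dia_fey D)); first exact: chart_bij (dia_valid D).
exact: chart_transports (dia_valid D).
Qed.

Let parts_d : finType := {P : {set {set 'I_d}} | partition P [set: 'I_d]}.

Lemma transversal_exists : exists (N : nat) (rep : 'I_N -> diagram d), dia_transversal rep.
Proof.
exists #|parts_d|, (fun k => std_diagram d_gt0 (valP (enum_val k : parts_d))) => D.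
have partD : partition (leg_partition (dia_fey D)) [set: 'I_d].
  exact: leg_partitionP (dia_valid D).
exists (enum_rank (exist (fun P => partition P [set: 'I_d]) _ partD : parts_d)); split.
  by apply/dia_equiv_sym/std_diagram_equiv; rewrite enum_rankK.
move=> k /leg_partition_equiv /=; rewrite std_leg_partition => DE; rewrite -[RHS]enum_valK; congr enum_rank.
by apply: val_inj.
Qed.

(** Taking leg partitions maps the transversal bijectively onto the set partitions: representatives
    with the same partition are equivalent to the same standard diagram, and each standard diagram
    has a representative. *)
Lemma sum_transversal (M : nmodType) (f : {set {set 'I_d}} -> M) (N : nat)
    (rep : 'I_N -> diagram d) : dia_transversal rep ->
  \sum_(k < N) f (leg_partition (dia_fey (rep k))) =
  \sum_(P : {set {set 'I_d}} | partition P [set: 'I_d]) f P.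
Proof.
move=> trv; pose lp k := leg_partition (dia_fey (rep k)).
have lpP k : partition (lp k) [set: 'I_d] := leg_partitionP (dia_valid (rep k)).
rewrite -[RHS]big_enum -big_enum -(big_map lp xpredT f).
apply/perm_big/uniq_perm; rewrite ?enum_uniq //.
  rewrite map_inj_uniq ?enum_uniq // => k k' kk'.
  have [k0 [_ uk0]] := trv (std_diagram d_gt0 (lpP k)).
  by rewrite -(uk0 k) ?(uk0 k') //; apply: std_diagram_equiv.
move=> P; rewrite mem_enum; apply/mapP/idP => [[k _ ->] | partP]; first exact: lpP.
have [k [/leg_partition_equiv Pk _]] := trv (std_diagram d_gt0 partP).
by exists k; rewrite ?mem_enum // /lp -Pk std_leg_partition.
Qed.

End Classification.

(** The sum over classes is taken over an arbitrary transversal, which expresses independence of the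
    representatives; the second conjunct shows that finite transversals exist. *)
Theorem theorem3 (R : comAlgType rat) (n : nat) (hn : (1 <= n)%N)
    (F G : 'I_n -> fps 'I_n R)
    (hF : forall k, fps_const (F k) = 0) (hG : forall k, fps_const (G k) = 0)
    (d : nat) (hd : (1 <= d)%N) (i : 'I_n) (j : 'I_d -> 'I_n) :
  let U : fps (gvar n) R :=
    fps_mul (fps_var R (v_s, i))
      (fps_mul
        (\big[@fps_mul _ R / @fps_one _ R]_(nu < d) fps_var R (v_ubar, j nu))
        (fps_exp (fps_add (fps_pairing v_sbar v_t F)
                          (fps_pairing v_tbar v_u G)))) in
  let tau_s : 'I_1 -> 'I_n := fun=> i in
  let tau_ubar : 'I_d -> 'I_n := j in
  [/\ gauss_integrable U,
      exists (N : nat) (rep : 'I_N -> diagram d), dia_transversal rep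
    & forall (N : nat) (rep : 'I_N -> diagram d), dia_transversal rep ->
      gauss_integral U =
      \sum_(k < N) (#|fey_aut (dia_fey (rep k))|%:R^-1 : rat)
                     *: amplitude F G tau_s tau_ubar (dia_fey (rep k))].
Proof.
move=> U tau_s tau_ubar; split.
- exact: (integrand_integrable F hG i j).
- exact: transversal_exists.
move=> N rep trv; rewrite [LHS](gauss_integral_comp F hG i j).
rewrite (faa_di_bruno hG j i) -(sum_transversal hd _ trv); apply: eq_bigr => k _.
rewrite (fey_aut_trivial (dia_valid _)) invr1 scale1r.
have [sg sg_bij sgD] := std_diagram_equiv hd (leg_partitionP (dia_valid (rep k))) erefl.
by rewrite (amplitude_transport sg_bij sgD) std_amplitude.
Qed.
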